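(* Let $p\ge 7$ be a prime and let $W=(a,b,c,\delta,w)$ be a weight system over $\mathbb{Z}_p$ of type $(n,m)$ with $n+2m=t+3$ and $t>0$. Then, after shifting weights (and up to re-indexing and equivalence of the pairs $(a_i,b_i)$), $W$ is a connected sum of weight systems $W_1,W_2$ of types $(3,0),(n-1,m)$, or of types $(1,1),(n+1,m-1)$, or of types $(1,1),(n-1,m)$.
   Context: $H_{n,m}=\mathbb{Z}_p^n\oplus(\mathbb{Z}_p[\tau]/(\tau^2))^m$ (product ring), with elements written $(x_1,\dots,x_n;y_1,\dots,y_m)$. Given $a,b\in\mathbb{Z}_p^n$, $c,\delta\in\mathbb{Z}_p^m$ with all $a_i,b_i,c_j\ne0$, define a $\mathbb{Z}_p$-linear map $\langle\ \rangle:H_{n,m}\to\mathbb{Z}_p$ by $$\langle (w_1,\dots,w_n;v_1+u_1\tau,\dots,v_m+u_m\tau)\rangle=\sum_i\frac{w_i}{a_ib_i}-\sum_j\frac{\delta_jv_j}{c_j^2}+\sum_j\frac{u_j}{c_j},$$ and $\rho=(\{a_i^2+b_i^2\};\{c_j^2+2c_j\delta_j\tau\})$, $e=(\{a_ib_i\};\{2c_j\tau\})$ in $H_{n,m}$. A weight system of type $(n,m)$, $n+2m\ge3$, is a collection $(a,b,c,\delta,w)$ with $a,b\in\mathbb{Z}_p^n$, $c,\delta\in\mathbb{Z}_p^m$ and $w=(w_k)_{k\in K}$, $w_k\in H_{n,m}$, $|K|=n+2m-2$, such that, with $w(\epsilon)=\sum_k\epsilon_kw_k$ for $\epsilon\in\{1,-1\}^K$: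 (W1) $a_i,b_i,c_j\ne0$; (W2) $\langle1\rangle=0$; (W3) $\langle w_k\rangle=0$ for all $k$; (W4) $\langle w_kw_l\rangle=\delta_{kl}$ (Kronecker delta); (W5) $\langle\rho\rangle=3|K|$; (W6) $\langle w(\epsilon)^3\rangle-\langle\rho w(\epsilon)\rangle=0$ for all $\epsilon$; (W7) $15\langle w(\epsilon)^4\rangle-30\langle w(\epsilon)^2\rho\rangle+7\langle\rho^2\rangle-4\langle e^2\rangle=0$ for all $\epsilon$; (W8) for all $k,\epsilon$, with $w=2w_k+w(\epsilon)$, $60\langle w^4\rangle-120\langle w^2\rho\rangle+28\langle\rho^2\rangle-16\langle e^2\rangle=5(\langle w^3\rangle-\langle\rho w\rangle)^2$. The index sets are $I=\{1,\dots,n\}$ (points), $J=\{1,\dots,m\}$ (surfaces), $K$ (weights). Shifting weights: replacing each $w_k$ by $w_k+t_k\cdot1$, $t_k\in\mathbb{Z}_p$; this again gives a weight system. The system is based at $i\in I$ if $(w_k)_i=0$ for all $k$, and based at $j\in J$ if the $j$-th surface component of each $w_k$ is a multiple of $\tau$. Pairs are equivalent under $(a,b)\sim(b,a)\sim(-a,-b)\sim(-b,-a)$; replacing pairs by equivalent ones preserves weight systems. Connected sum at points: given weight systems $W_1,W_2$ (data marked $(1),(2)$, index sets $I_s,J_s,K_s$) based at $i_1\in I_1$, $i_2\in I_2$ with $a_{i_1}(1)b_{i_1}(1)=-a_{i_2}(2)b_{i_2}(2)$ and $a_{i_1}(1)^2+b_{i_1}(1)^2=a_{i_2}(2)^2+b_{i_2}(2)^2$,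 the connected sum has index sets $I=(I_1\setminus\{i_1\})\sqcup(I_2\setminus\{i_2\})$, $J=J_1\sqcup J_2$, $K=K_1\sqcup K_2$; $a,b,c,\delta$ are inherited; and for $k\in K_s$, $w_k$ has the components of the original $w_k$ on indices from $I_s,J_s$ and is $0$ on the others. Connected sum at surfaces: given $W_1,W_2$ based at $j_1\in J_1$, $j_2\in J_2$ with $c_{j_1}(1)=c_{j_2}(2)$, the connected sum has $I=I_1\sqcup I_2$, $J=J_1\sqcup(J_2\setminus\{j_2\})$, $K=K_1\sqcup K_2$; $a,b,c$ are inherited; $\delta$ is inherited except that at $j_1$ it is $\delta_{j_1}(1)+\delta_{j_2}(2)$; for $k\in K_1$, $w_k$ has its original components on $I_1\sqcup J_1$ and $0$ elsewhere; for $k\in K_2$, $w_k$ has its original components on $I_2\sqcup(J_2\setminus\{j_2\})$, its component at $j_1$ is the original component at $j_2$, and it is $0$ elsewhere. *)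

(* Defs.v *)
From HB Require Import structures.
From mathcomp Require Import all_boot all_order all_algebra.

Set Implicit Arguments.
Unset Strict Implicit.
Unset Printing Implicit Defensive.

Import GRing.Theory.
Local Open Scope ring_scope.

(* All constructions are indexed by arbitrary finite types I (points),
   J (surfaces) and K (weights), so that the index sets of a connected sum are
   literally disjoint unions of index sets.  Z_p is the prime field 'F_p. *)

(* F_p[tau]/(tau^2); an element x is x`_0 + x`_1 tau. *)
Notation dual p := {poly %/ 'X^2 : {poly 'F_p}}.
Definition tau (p : nat) : dual p := 'qX.

(* The regular module ('F_p)^o makes H_{n,m} both a ring and an 'F_p-module. *)
Notation wring p I J := ({ffun I -> ('F_p)^o} * {ffun J -> dual p})%type.

Record weight_data (p : nat) (I J K : finType) := WeightData {
  wa : I -> 'F_p;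
  wb : I -> 'F_p;
  wc : J -> 'F_p;
  wdelta : J -> 'F_p;
  weight : K -> wring p I J }.

Section WeightSystem.

Variables (p : nat) (I J K : finType) (W : weight_data p I J K).

Local Notation a := (wa W).
Local Notation b := (wb W).
Local Notation c := (wc W).
Local Notation delta := (wdelta W).
Local Notation w := (weight W).

Definition bracket (x : wring p I J) : 'F_p :=
  \sum_i x.1 i / (a i * b i)
  - \sum_j delta j * (x.2 j)`_0 / c j ^+ 2
  + \sum_j (x.2 j)`_1 / c j.

Lemma bracket_is_linear (s : 'F_p) (x y : wring p I J) :
  bracket (s *: x + y) = s * bracket x + bracket y.
Proof.
rewrite /bracket mulrDr mulrBr !mulr_sumr.
rewrite [RHS]addrACA (addrACA (\sum_i _)) -opprD -!big_split /=.
congr (_ - _ + _); apply: eq_bigr => i _;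
  rewrite !ffunE /= ?coefD ?coefZ ?mulrDr !mulrDl -?mulrA //.
by rewrite mulrCA.
Qed.

Definition rho : wring p I J :=
  ([ffun i => a i ^+ 2 + b i ^+ 2],
   [ffun j => (c j ^+ 2)%:A + (2 * c j * delta j) *: tau p]).

Definition euler : wring p I J :=
  ([ffun i => a i * b i], [ffun j => (2 * c j) *: tau p]).

(* The sign vector in {1,-1}^K is encoded by booleans, true meaning -1. *)
Definition signed_weight (eps : K -> bool) : wring p I J :=
  \sum_k (-1) ^+ eps k *: w k.

Local Notation "<< x >>" := (bracket x).

Definition weight_system : Prop :=
  [/\ (3 <= #|I| + 2 * #|J|)%N,
      #|K| = (#|I| + 2 * #|J| - 2)%N,
      (forall i, a i != 0 /\ b i != 0) /\ (forall j, c j != 0) &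
  [/\ << 1 >> = 0,
      forall k, << w k >> = 0,
      forall k l, << w k * w l >> = (k == l)%:R &
  [/\ << rho >> = (3 * #|K|)%:R,
      forall eps, let x := signed_weight eps in
        << x ^+ 3 >> - << rho * x >> = 0,
      forall eps, let x := signed_weight eps in
        15 * << x ^+ 4 >> - 30 * << x ^+ 2 * rho >>
        + 7 * << rho ^+ 2 >> - 4 * << euler ^+ 2 >> = 0 &
      forall k eps, let x := 2 *: w k + signed_weight eps in
        60 * << x ^+ 4 >> - 120 * << x ^+ 2 * rho >>
        + 28 * << rho ^+ 2 >> - 16 * << euler ^+ 2 >>
        = 5 * (<< x ^+ 3 >> - << rho * x >>) ^+ 2]]].

Definition shift (s : K -> 'F_p) : weight_data p I J K :=
  WeightData a b c delta (fun k => w k + s k *: (1 : wring p I J)).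

Definition based_at_point (i : I) : Prop := forall k, (w k).1 i = 0.

Definition based_at_surface (j : J) : Prop :=
  forall k, exists x : dual p, (w k).2 j = x * tau p.

End WeightSystem.

Definition pair_equiv (p : nat) (x y : 'F_p * 'F_p) : Prop :=
  [\/ y = x, y = (x.2, x.1), y = (- x.1, - x.2) | y = (- x.2, - x.1)].

Definition same_up_to_reindexing (p : nat) (I J K I' J' K' : finType)
    (W : weight_data p I J K) (W' : weight_data p I' J' K') : Prop :=
  exists (f : I -> I') (g : J -> J') (h : K -> K'),
    [/\ bijective f, bijective g & bijective h] /\
    [/\ forall i, pair_equiv (wa W i, wb W i) (wa W' (f i), wb W' (f i)),
        forall j, wc W j = wc W' (g j),
        forall j, wdelta W j = wdelta W' (g j),
        forall k i, (weight W k).1 i = (weight W' (h k)).1 (f i) &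
        forall k j, (weight W k).2 j = (weight W' (h k)).2 (g j)].

Section ConnectedSum.

Variables (p : nat) (I1 J1 K1 I2 J2 K2 : finType).
Variables (W1 : weight_data p I1 J1 K1) (W2 : weight_data p I2 J2 K2).

Definition point_summable (i1 : I1) (i2 : I2) : Prop :=
  [/\ based_at_point W1 i1, based_at_point W2 i2,
      wa W1 i1 * wb W1 i1 = - (wa W2 i2 * wb W2 i2) &
      wa W1 i1 ^+ 2 + wb W1 i1 ^+ 2 = wa W2 i2 ^+ 2 + wb W2 i2 ^+ 2].

Definition point_sum (i1 : I1) (i2 : I2) :
    weight_data p ({i : I1 | i != i1} + {i : I2 | i != i2})%type
                  (J1 + J2)%type (K1 + K2)%type :=
  WeightData
    (fun i => match i with inl x => wa W1 (val x) | inr x => wa W2 (val x) end)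
    (fun i => match i with inl x => wb W1 (val x) | inr x => wb W2 (val x) end)
    (fun j => match j with inl y => wc W1 y | inr y => wc W2 y end)
    (fun j => match j with inl y => wdelta W1 y | inr y => wdelta W2 y end)
    (fun k => match k with
     | inl k1 =>
       ([ffun i => if i is inl x then (weight W1 k1).1 (val x) else 0],
        [ffun j => if j is inl y then (weight W1 k1).2 y else 0])
     | inr k2 =>
       ([ffun i => if i is inr x then (weight W2 k2).1 (val x) else 0],
        [ffun j => if j is inr y then (weight W2 k2).2 y else 0])
     end).

Definition surface_summable (j1 : J1) (j2 : J2) : Prop :=
  [/\ based_at_surface W1 j1, based_at_surface W2 j2 & wc W1 j1 = wc W2 j2].

Definition surface_sum (j1 : J1) (j2 : J2) :
    weight_data p (I1 + I2)%type (J1 + {j : J2 | j != j2})%type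
                  (K1 + K2)%type :=
  WeightData
    (fun i => match i with inl x => wa W1 x | inr x => wa W2 x end)
    (fun i => match i with inl x => wb W1 x | inr x => wb W2 x end)
    (fun j => match j with inl y => wc W1 y | inr y => wc W2 (val y) end)
    (fun j => match j with
     | inl y => wdelta W1 y + (if y == j1 then wdelta W2 j2 else 0)
     | inr y => wdelta W2 (val y)
     end)
    (fun k => match k with
     | inl k1 =>
       ([ffun i => if i is inl x then (weight W1 k1).1 x else 0],
        [ffun j => if j is inl y then (weight W1 k1).2 y else 0])
     | inr k2 =>
       ([ffun i => if i is inr x then (weight W2 k2).1 x else 0],
        [ffun j => match j with
         | inl y => if y == j1 then (weight W2 k2).2 j2 else 0
         | inr y => (weight W2 k2).2 (val y)
         end])
     end).

End ConnectedSum.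

(* A weight system of type (n,m) is one with I = 'I_n and J = 'I_m. *)
Definition is_connected_sum (p n1 m1 n2 m2 : nat) (I J K : finType)
    (W : weight_data p I J K) : Prop :=
  exists (K1 K2 : finType)
         (W1 : weight_data p 'I_n1 'I_m1 K1)
         (W2 : weight_data p 'I_n2 'I_m2 K2),
    [/\ weight_system W1, weight_system W2 &
        (exists i1 i2, point_summable W1 W2 i1 i2 /\
           same_up_to_reindexing W (point_sum W1 W2 i1 i2))
        \/ (exists j1 j2, surface_summable W1 W2 j1 j2 /\
           same_up_to_reindexing W (surface_sum W1 W2 j1 j2))].

(* Main.v *)
(* Write t_kl = <w_k^2 w_l>.  Third differences of (W6) in the signs give
   <w_k w_l w_m> = 0 for distinct indices, and (W6)-(W8) together give
   <w_k^2 w_l w_m> = t_kl t_km for l <> m.  Since the orthogonal complement of 1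
   and all the w_k consists of the scalars (count dimensions), this yields
     (w_k - t_lk) (w_l - t_kl) = 0   and   (t_kl - t_ml) (t_km - t_lm) = 0
   for distinct indices.  The second relation says that the weights are arranged
   like the vertices of a tree, and a leaf is a weight k for which t_lk does not
   depend on l.  After a shift, x = w_k kills all other weights, and then
   x h = <x h> x^2 + (<x^2 h> - <x^3> <x h>) x for every h.  Taking for h the
   units of the single components shows that x is supported on two points, or on
   one surface, or on a point and the nilpotent part of a surface, and the
   conditions <x> = 0, <x^2> = 1, <rho x> = <x^3> and
   <rho x^2> = 5 <x^4> - 3 <x^3>^2 determine (a, b, c, delta) there: it is the
   data of a linear action on CP^2, which splits off as W_1.  The complementary
   summand is a weight system because all the conditions are additive over
   connected sums. *)

(* The bound p >= 7 makes 2, 3 and 5 invertible: the finite differences in the signs come out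
   multiplied by 48, 24 and 960. In (W8) the sign -1 at k gives back another signed weight, so only
   the sign +1 carries information. Its argument w(eps) + 2 w_k then continues the progression
   w(eps) - 2 w_k, w(eps) by one step, and the second difference isolates <w_k^2 w(eps)^2>. A leaf
   is needed because the shift of w_k in (w_k - t_lk) (w_l - t_kl) = 0 has to serve all l at once.
   It exists as soon as there are two weights, which is what t > 0 provides; a second weight is also
   what makes multiplication by x map H into the span of x and x^2, without a scalar term. The
   conditions on the complementary summand are not checked directly: its data are read off, W is
   shown to be the connected sum, and the conditions of W_1 are subtracted from those of W. The
   summand W_1 has either three isolated points, or a point and a line; in the second case it is
   glued at the point or along the line, whence three cases. *)
From HB Require Import structures.
Require Import Defs.
From mathcomp Require Import all_boot all_order all_algebra ring zify.

Set Implicit Arguments.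
Unset Strict Implicit.
Unset Printing Implicit Defensive.

Import GRing.Theory.
Local Open Scope ring_scope.

(** Commutativity makes H a [comPzRingType], which the abstract moment lemmas and [ring] require. *)
Lemma ffun_mulC (aT : finType) (R : comPzRingType) :
  commutative (@GRing.mul {ffun aT -> R}).
Proof. by move=> f g; apply/ffunP=> i; rewrite !ffunE mulrC. Qed.

HB.instance Definition _ (aT : finType) (R : comPzRingType) :=
  GRing.PzRing_hasCommutativeMul.Build {ffun aT -> R} (@ffun_mulC aT R).

(** * Coordinates on the ring H *)

Section DualNumbers.

Variable p : nat.
Implicit Types x y : dual p.

Lemma mk_monic_X2 : mk_monic ('X^2 : {poly 'F_p}) = 'X^2.
Proof. by rewrite /mk_monic size_polyXn monicXn. Qed.

Lemma dual_size x : (size x <= 2)%N.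
Proof.
rewrite -ltnS (leq_trans (size_mk_monic x)) //.
by rewrite mk_monic_X2 size_polyXn.
Qed.

Lemma dualP x y : x`_0 = y`_0 -> x`_1 = y`_1 -> x = y.
Proof.
move=> e0 e1; apply/val_inj/polyP => -[|[|i]] //=.
by rewrite !nth_default // (leq_trans (dual_size _)).
Qed.

Lemma dual_coef_in (q : {poly 'F_p}) (i : nat) :
  (i < 2)%N -> (val (in_qpoly 'X^2 q))`_i = q`_i.
Proof.
move=> i2; rewrite /= mk_monic_X2.
rewrite [in RHS](Pdiv.RingMonic.rdivp_eq (monicXn _ 2) q).
by rewrite coefD coefMXn i2 add0r.
Qed.

Lemma coef0_dualM x y : (x * y)`_0 = x`_0 * y`_0.
Proof. by rewrite dual_coef_in // coef0M. Qed.

Lemma coef1_dualM x y : (x * y)`_1 = x`_0 * y`_1 + x`_1 * y`_0.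
Proof. by rewrite dual_coef_in // coefM !big_ord_recl big_ord0 addr0. Qed.

Lemma coef0_tau : (tau p)`_0 = 0.
Proof. by rewrite dual_coef_in // coefX. Qed.

Lemma coef1_tau : (tau p)`_1 = 1.
Proof. by rewrite dual_coef_in // coefX. Qed.

Lemma coef0_dual1 : (1 : dual p)`_0 = 1.
Proof. by rewrite /= coefC. Qed.

Lemma coef1_dual1 : (1 : dual p)`_1 = 0.
Proof. by rewrite /= coefC. Qed.

Lemma coef_dualD x y i : (x + y)`_i = x`_i + y`_i.
Proof. exact: coefD. Qed.

Lemma coef_dualZ s x i : (s *: x)`_i = s * x`_i.
Proof. exact: coefZ. Qed.

Lemma coef_dual0 i : (0 : dual p)`_i = 0.
Proof. exact: coef0. Qed.

Definition dualE := (coef0_dualM, coef1_dualM, coef0_tau, coef1_tau,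
  coef0_dual1, coef1_dual1, coef_dualD, coef_dualZ, coef_dual0).

Lemma card_dual : prime p -> #|{: dual p}| = (p ^ 2)%N.
Proof.
move=> pp; rewrite card_monic_qpoly ?size_polyXn ?monicXn //.
by rewrite card_Fp.
Qed.

End DualNumbers.

Section Wring.

Variables (p : nat) (I J : finType).
Local Notation H := (wring p I J).
Implicit Types x y : H.

(* An element of H has components [pt x i] at the points and
   [sv x j + st x j * tau] at the surfaces. *)
Definition pt x i : 'F_p := x.1 i.
Definition sv x j : 'F_p := (x.2 j)`_0.
Definition st x j : 'F_p := (x.2 j)`_1.
Definition sc (s : 'F_p) : H := s *: (1 : H).

Lemma wringP x y : pt x =1 pt y -> sv x =1 sv y -> st x =1 st y -> x = y.
Proof.
case: x y => [x1 x2] [y1 y2] h1 h2 h3.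
by congr (_, _); apply/ffunP => // j; apply: dualP; [exact: h2 | exact: h3].
Qed.

Lemma ptM x y i : pt (x * y) i = pt x i * pt y i.
Proof. by rewrite /pt ffunE. Qed.
Lemma svM x y j : sv (x * y) j = sv x j * sv y j.
Proof. by rewrite /sv ffunE coef0_dualM. Qed.
Lemma stM x y j : st (x * y) j = sv x j * st y j + st x j * sv y j.
Proof. by rewrite /sv /st ffunE coef1_dualM. Qed.

Lemma ptX2 x i : pt (x ^+ 2) i = pt x i * pt x i.
Proof. exact: ptM. Qed.
Lemma svX2 x j : sv (x ^+ 2) j = sv x j * sv x j.
Proof. exact: svM. Qed.
Lemma stX2 x j : st (x ^+ 2) j = sv x j * st x j + st x j * sv x j.
Proof. exact: stM. Qed.

Lemma ptD x y i : pt (x + y) i = pt x i + pt y i.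
Proof. by rewrite /pt ffunE. Qed.
Lemma svD x y j : sv (x + y) j = sv x j + sv y j.
Proof. by rewrite /sv ffunE coef_dualD. Qed.
Lemma stD x y j : st (x + y) j = st x j + st y j.
Proof. by rewrite /st ffunE coef_dualD. Qed.

Lemma ptZ s x i : pt (s *: x) i = s * pt x i.
Proof. by rewrite /pt ffunE. Qed.
Lemma svZ s x j : sv (s *: x) j = s * sv x j.
Proof. by rewrite /sv ffunE coef_dualZ. Qed.
Lemma stZ s x j : st (s *: x) j = s * st x j.
Proof. by rewrite /st ffunE coef_dualZ. Qed.

Lemma pt1 i : pt 1 i = 1. Proof. by rewrite /pt ffunE. Qed.
Lemma sv1 j : sv 1 j = 1. Proof. by rewrite /sv ffunE coef0_dual1. Qed.
Lemma st1 j : st 1 j = 0. Proof. by rewrite /st ffunE coef1_dual1. Qed.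

Lemma pt0 i : pt 0 i = 0. Proof. by rewrite /pt ffunE. Qed.
Lemma sv0 j : sv 0 j = 0. Proof. by rewrite /sv ffunE coef_dual0. Qed.
Lemma st0 j : st 0 j = 0. Proof. by rewrite /st ffunE coef_dual0. Qed.

Lemma scE s : sc s = s *: (1 : H). Proof. by []. Qed.

Lemma pt_sc s i : pt (sc s) i = s.
Proof. by rewrite /sc ptZ pt1 mulr1. Qed.
Lemma sv_sc s j : sv (sc s) j = s.
Proof. by rewrite /sc svZ sv1 mulr1. Qed.
Lemma st_sc s j : st (sc s) j = 0.
Proof. by rewrite /sc stZ st1 mulr0. Qed.

Lemma scaleE s x : s *: x = sc s * x.
Proof.
apply: wringP => i; rewrite ?ptZ ?svZ ?stZ ?ptM ?svM ?stM.
- by rewrite pt_sc.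
- by rewrite sv_sc.
- by rewrite sv_sc st_sc mul0r addr0.
Qed.

Lemma sc1 : sc 1 = 1.
Proof. exact: scale1r. Qed.

Lemma scD s t : sc (s + t) = sc s + sc t.
Proof. exact: scalerDl. Qed.

Lemma scM s t : sc (s * t) = sc s * sc t.
Proof. by rewrite -scaleE /sc scalerA. Qed.

Definition mkw (f : I -> 'F_p) (u v : J -> 'F_p) : H :=
  ([ffun i => f i], [ffun j => u j *: (1 : dual p) + v j *: tau p]).

Lemma pt_mkw f u v i : pt (mkw f u v) i = f i.
Proof. by rewrite /pt ffunE. Qed.
Lemma sv_mkw f u v j : sv (mkw f u v) j = u j.
Proof. by rewrite /sv ffunE !dualE mulr1 mulr0 addr0. Qed.
Lemma st_mkw f u v j : st (mkw f u v) j = v j.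
Proof. by rewrite /st ffunE !dualE mulr1 mulr0 add0r. Qed.

Lemma card_wring : prime p -> #|{: H}| = (p ^ (#|I| + 2 * #|J|))%N.
Proof.
move=> pp; rewrite card_prod !card_ffun card_dual // -expnM.
by rewrite (card_Fp pp) expnD.
Qed.

End Wring.

Arguments sc {p I J} s : simpl never.
(* Unification would otherwise unfold the ring structure of H. *)
#[global] Opaque sc mkw.

Lemma sum_single (R : pzRingType) (T : finType) (i : T) (f : T -> R) :
  (forall j, j != i -> f j = 0) -> \sum_j f j = f i.
Proof. by move=> f0; rewrite (bigD1 i) //= big1 ?addr0. Qed.

(** * Small scalars and equivalence of pairs *)

Section Fp.

Variable p : nat.
Hypotheses (pp : prime p) (p7 : (7 <= p)%N).

Lemma Fp_nat_neq0 k : (0 < k < 7)%N -> k%:R != 0 :> 'F_p.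
Proof.
move=> /andP[k0 k7].
rewrite -(dvdn_pcharf (pchar_Fp pp)) gtnNdvd //.
exact: leq_trans k7 p7.
Qed.

(** [bracket], [rho] and [euler] see a pair only through [a * b] and [a ^+ 2 + b ^+ 2]. These
    determine it up to equivalence: [a ^+ 2] is a root of (T - c^2)(T - d^2), and the product then
    fixes [b]. *)
Lemma pair_equiv_of_invariants (a b c d : 'F_p) : a != 0 ->
  a * b = c * d -> a ^+ 2 + b ^+ 2 = c ^+ 2 + d ^+ 2 ->
  pair_equiv (a, b) (c, d).
Proof.
move=> a0 eM eS.
have : (a - c) * (a + c) * ((a - d) * (a + d)) = 0.
  transitivity (a ^+ 4 - a ^+ 2 * (c ^+ 2 + d ^+ 2) + (c * d) ^+ 2).
    by ring.
  by rewrite -eS -eM; ring.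
have canc (u : 'F_p) : a * b = a * u -> u = b by move/(mulfI a0).
move/eqP; rewrite !mulf_eq0 !subr_eq0 !addr_eq0.
move=> /orP[/orP[]|/orP[]] /eqP E.
- by constructor 1; rewrite E (canc d) // eM E.
- by constructor 3; rewrite /= E opprK -(canc (- d)) ?opprK // eM E mulrNN.
- by constructor 2; rewrite /= E (canc c) // eM E mulrC.
- constructor 4; rewrite /= E opprK -(canc (- c)) ?opprK // eM E.
  by rewrite mulrNN mulrC.
Qed.

End Fp.

(** * Moments of a linear functional *)

(* Take a branch t k l = t m l at l of minimal size; then m is a leaf. *)
Lemma exists_leaf (K : finType) (T : eqType) (t : K -> K -> T) :
  (1 < #|K|)%N ->
  (forall k l m, k != l -> k != m -> l != m ->
     (t k l == t m l) || (t k m == t l m)) ->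
  exists k, forall l m, l != k -> m != k -> t l k = t m k.
Proof.
move=> /card_gt1P[k0 [l0 [_ _ kl0]]] tree.
pose branch (q : K * K) := [set k | k != q.1 & t k q.1 == t q.2 q.1].
have [[l m] /= lm min_lm] := arg_minnP (fun q => #|branch q|)
  (i0 := (k0, l0)) (P := [pred q | q.1 != q.2]) kl0.
suff leaf a : a != m -> t a m = t l m.
  by exists m => a b am bm; rewrite (leaf a) // (leaf b).
move=> am; apply/eqP/negPn/negP => tam.
have al : a != l by apply: contraNneq tam => ->.
(* The branch of [a] at [m] avoids [l], so the tree relation puts it inside the branch of [m] at
   [l]; it misses [m] and is strictly smaller. *)
have /(_ (m, a)) := min_lm; rewrite /= eq_sym => /(_ am); apply/negP.
rewrite -ltnNge; apply: proper_card; apply/properP; split.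
  apply/subsetP => k; rewrite !inE /= => /andP[km /eqP tk].
  have kl : k != l by apply: contraNneq tam => <-; rewrite tk.
  by rewrite kl; have := tree k l m kl km lm; rewrite tk (negbTE tam) orbF.
by exists m; rewrite !inE /= eqxx // eq_sym lm.
Qed.

(* The left-hand sides of (W6) and (W7) are [cubic w] and [quartic C w] with
   C = 7 <rho^2> - 4 <e^2>; (W8) reads 4 quartic = 5 cubic^2. *)
Section AdditiveFunctional.

Variables (F : fieldType) (H : comPzRingType) (br : H -> F).
Hypothesis brD : {morph br : x y / x + y}.
Hypotheses (F2 : 2%:R != 0 :> F) (F3 : 3%:R != 0 :> F) (F5 : 5%:R != 0 :> F).

Lemma br0 : br 0 = 0.
Proof. by apply: (addrI (br 0)); rewrite -brD !addr0. Qed.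

Lemma brN : {morph br : x / - x}.
Proof. by move=> x; apply: (addrI (br x)); rewrite -brD !subrr br0. Qed.

Lemma brB : {morph br : x y / x - y}.
Proof. by move=> x y; rewrite brD brN. Qed.

Lemma br_nat n x : br (n%:R * x) = n%:R * br x.
Proof.
elim: n => [|n IHn]; first by rewrite !mul0r br0.
by rewrite -!natr1 !mulrDl brD IHn !mul1r.
Qed.

Variable rho : H.
Implicit Types a b c x y z : H.

Definition cubic x := br (x ^+ 3) - br (rho * x).
Definition quartic C x := 15 * br (x ^+ 4) - 30 * br (x ^+ 2 * rho) + C.

Lemma mul4_quartic A B x : 4 * quartic (7 * A - 4 * B) x
  = 60 * br (x ^+ 4) - 120 * br (x ^+ 2 * rho) + 28 * A - 16 * B.
Proof. by rewrite /quartic; ring. Qed.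

(** The alternating sum of a cubic over a cube with edges -2a, -2b, -2c is its polarisation, here 3!
    * 2^3 = 48 times [a * b * c]; the linear term [rho * x] cancels. *)
Lemma cubic_third_difference a b c z :
  cubic z = 0 -> cubic (z - 2 * a) = 0 -> cubic (z - 2 * b) = 0 ->
  cubic (z - 2 * c) = 0 -> cubic (z - 2 * a - 2 * b) = 0 ->
  cubic (z - 2 * a - 2 * c) = 0 -> cubic (z - 2 * b - 2 * c) = 0 ->
  cubic (z - 2 * a - 2 * b - 2 * c) = 0 ->
  br (a * b * c) = 0.
Proof.
have cubicE x : cubic x = br (x ^+ 3 - rho * x) by rewrite brB.
rewrite !cubicE => z0 za zb zc zab zac zbc zabc.
have F48 : 48%:R != 0 :> F.
  have -> : 48%:R = 2 ^+ 4 * 3 :> F by ring.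
  by rewrite mulf_neq0 ?expf_neq0.
apply: (mulfI F48); rewrite mulr0 -br_nat.
(* The existential hides the body of [P], so that [brD] and [brN] split the sum of eight values but
   not the values themselves. *)
have [P PE] : exists P, forall x : H, P x = x ^+ 3 - rho * x by eexists.
have -> : 48%:R * (a * b * c) = (P z - P (z - 2 * a) - P (z - 2 * b)
    - P (z - 2 * c) + P (z - 2 * a - 2 * b) + P (z - 2 * a - 2 * c)
    + P (z - 2 * b - 2 * c) - P (z - 2 * a - 2 * b - 2 * c)).
  by rewrite !PE; ring.
by rewrite !(brD, brN) !PE z0 za zb zc zab zac zbc zabc !(subr0, addr0).
Qed.

(** [br] is only assumed additive, so the coefficient [c] is a natural number, which [br_nat] can
    pull out. *)
Lemma br_sqrD (c : nat) x y :
  br ((x + c%:R * y) ^+ 2 * rho)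
  = br (x ^+ 2 * rho) + 2 * c%:R * br (x * y * rho)
    + c%:R ^+ 2 * br (y ^+ 2 * rho).
Proof.
have -> : (x + c%:R * y) ^+ 2 * rho = x ^+ 2 * rho
    + 2%:R * (c%:R * (x * y * rho)) + c%:R * (c%:R * (y ^+ 2 * rho)) by ring.
by rewrite !brD !br_nat; ring.
Qed.

Lemma br_cubeD (c : nat) x y :
  br ((x + c%:R * y) ^+ 3)
  = br (x ^+ 3) + 3 * c%:R * br (x ^+ 2 * y) + 3 * c%:R ^+ 2 * br (x * y ^+ 2)
    + c%:R ^+ 3 * br (y ^+ 3).
Proof.
have -> : (x + c%:R * y) ^+ 3 = x ^+ 3
    + 3%:R * (c%:R * (x ^+ 2 * y)) + 3%:R * (c%:R * (c%:R * (x * y ^+ 2)))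
    + c%:R * (c%:R * (c%:R * (y ^+ 3))) by ring.
by rewrite !brD !br_nat; ring.
Qed.

Lemma br_fourthD (c : nat) x y :
  br ((x + c%:R * y) ^+ 4)
  = br (x ^+ 4) + 4 * c%:R * br (x ^+ 3 * y)
    + 6 * c%:R ^+ 2 * br (x ^+ 2 * y ^+ 2)
    + 4 * c%:R ^+ 3 * br (x * y ^+ 3) + c%:R ^+ 4 * br (y ^+ 4).
Proof.
have -> : (x + c%:R * y) ^+ 4 = x ^+ 4
    + 4%:R * (c%:R * (x ^+ 3 * y)) + 6%:R * (c%:R * (c%:R * (x ^+ 2 * y ^+ 2)))
    + 4%:R * (c%:R * (c%:R * (c%:R * (x * y ^+ 3))))
    + c%:R * (c%:R * (c%:R * (c%:R * (y ^+ 4)))) by ring.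
by rewrite !brD !br_nat; ring.
Qed.

Lemma cubicDE x a : cubic (x + 2 * a) = cubic x + 6 * br (x ^+ 2 * a)
  + 12 * br (x * a ^+ 2) + 8 * br (a ^+ 3) - 2 * br (rho * a).
Proof.
have -> : cubic (x + 2 * a) = br ((x + 2%:R * a) ^+ 3)
    - br (rho * x + 2%:R * (rho * a)) by rewrite /cubic mulrDr mulrCA.
by rewrite br_cubeD brD br_nat /cubic; ring.
Qed.

Lemma cubicBE x a : cubic (x - 2 * a) = cubic x - 6 * br (x ^+ 2 * a)
  + 12 * br (x * a ^+ 2) - 8 * br (a ^+ 3) + 2 * br (rho * a).
Proof.
rewrite -mulrN cubicDE !mulrN sqrrN brN.
have -> : (- a) ^+ 3 = - a ^+ 3 by ring.
by rewrite !brN; ring.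
Qed.

Lemma quarticDE C x a : quartic C (x + 2 * a) = quartic C x
  + 120 * br (x ^+ 3 * a) + 360 * br (x ^+ 2 * a ^+ 2)
  + 480 * br (x * a ^+ 3) + 240 * br (a ^+ 4)
  - 120 * br (x * a * rho) - 120 * br (a ^+ 2 * rho).
Proof. by rewrite /quartic br_fourthD br_sqrD; ring. Qed.

Lemma quarticBE C x a : quartic C (x - 2 * a) = quartic C x
  - 120 * br (x ^+ 3 * a) + 360 * br (x ^+ 2 * a ^+ 2)
  - 480 * br (x * a ^+ 3) + 240 * br (a ^+ 4)
  + 120 * br (x * a * rho) - 120 * br (a ^+ 2 * rho).
Proof.
rewrite -mulrN quarticDE !mulrN !mulNr sqrrN !brN.
have -> : (- a) ^+ 3 = - a ^+ 3 by ring.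
have -> : (- a) ^+ 4 = a ^+ 4 by ring.
by rewrite !mulrN !brN; ring.
Qed.

(** As the forms vanish at z and z - 2a, their values at z + 2a are second differences: 240 times
    the left-hand side for [quartic], and 24 [br (z * a ^+ 2)] for [cubic]. The factor is 4 * 240 =
    960, and 5 * 24^2 = 3 * 960. *)
Lemma square_moment C a z :
  cubic z = 0 -> cubic (z - 2 * a) = 0 ->
  quartic C z = 0 -> quartic C (z - 2 * a) = 0 ->
  4 * quartic C (z + 2 * a) = 5 * cubic (z + 2 * a) ^+ 2 ->
  3 * br (a ^+ 2 * z ^+ 2) + 2 * br (a ^+ 4) - br (a ^+ 2 * rho)
  = 3 * br (a ^+ 2 * z) ^+ 2.
Proof.
rewrite cubicBE cubicDE quarticBE quarticDE => -> ca -> qa E.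
have F960 : 960%:R != 0 :> F.
  have -> : 960%:R = 2 ^+ 6 * 3 * 5 :> F by ring.
  by rewrite !mulf_neq0 ?expf_neq0.
apply: (mulfI F960); rewrite ![a ^+ 2 * z ^+ _]mulrC ![a ^+ 2 * z]mulrC.
set E1 := (X in _ = 5 * X ^+ 2) in E.
have {}E1E : E1 = 24 * br (z * a ^+ 2).
  by rewrite -[LHS]addr0 -ca /E1; ring.
move: E qa; rewrite {}E1E.
set A := (X in 4 * X); set B := (X in X = 0) => E qa.
transitivity (4 * A + 4 * B); first by rewrite /A /B; ring.
by rewrite E qa; ring.
Qed.

(** The mixed difference of the identity M in the directions b and c removes the constant [Q] and
    leaves 24 times the claim. *)
Lemma square_moment_bilinear Q a b c z :
  let M x := 3 * br (a ^+ 2 * x ^+ 2) + Q = 3 * br (a ^+ 2 * x) ^+ 2 in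
  M z -> M (z - 2 * b) -> M (z - 2 * c) -> M (z - 2 * b - 2 * c) ->
  br (a ^+ 2 * (b * c)) = br (a ^+ 2 * b) * br (a ^+ 2 * c).
Proof.
move=> M; rewrite /M.
have linE x y :
    br (a ^+ 2 * (x - 2 * y)) = br (a ^+ 2 * x) - 2 * br (a ^+ 2 * y).
  by rewrite mulrBr brB mulrCA br_nat.
have sqrE x y : br (a ^+ 2 * (x - 2 * y) ^+ 2) = br (a ^+ 2 * x ^+ 2)
   - 4 * br (a ^+ 2 * (x * y)) + 4 * br (a ^+ 2 * y ^+ 2).
  have -> : a ^+ 2 * (x - 2 * y) ^+ 2 = a ^+ 2 * x ^+ 2
      - 4%:R * (a ^+ 2 * (x * y)) + 4%:R * (a ^+ 2 * y ^+ 2) by ring.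
  by rewrite brD brB !br_nat.
have prodE : br (a ^+ 2 * ((z - 2 * b) * c))
    = br (a ^+ 2 * (z * c)) - 2 * br (a ^+ 2 * (b * c)).
  rewrite -br_nat -brB; congr br; ring.
rewrite !sqrE prodE !linE => Mz Mb Mc Mbc.
have F24 : 24%:R != 0 :> F.
  have -> : 24%:R = 2 ^+ 3 * 3 :> F by ring.
  by rewrite mulf_neq0 ?expf_neq0.
apply: (mulfI F24).
have := congr2 +%R (congr2 +%R Mz Mbc) (congr1 -%R (congr2 +%R Mb Mc)).
set L := LHS; set R := RHS => LR.
transitivity L; first by rewrite /L; ring.
by rewrite LR /R; ring.
Qed.

(** Multiplied by [a], the element [z] acts like [a], so every mixed moment of [a] and [z] is a
    moment of [a] alone. The first difference of [cubic] then gives one identity and [square_moment]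
    the other. *)
Lemma isolated_moments C a z :
  a * (z - a) = 0 ->
  cubic z = 0 -> cubic (z - 2 * a) = 0 ->
  quartic C z = 0 -> quartic C (z - 2 * a) = 0 ->
  4 * quartic C (z + 2 * a) = 5 * cubic (z + 2 * a) ^+ 2 ->
  br (rho * a) = br (a ^+ 3) /\
  br (rho * a ^+ 2) = 5 * br (a ^+ 4) - 3 * br (a ^+ 3) ^+ 2.
Proof.
move=> /eqP; rewrite mulrBr subr_eq0 => /eqP az cz ca qz qa E.
have a2z : a ^+ 2 * z = a ^+ 3 by rewrite expr2 -mulrA az; ring.
have a2z2 : a ^+ 2 * z ^+ 2 = a ^+ 4.
  by rewrite -exprMn az; ring.
split.
  move: ca; rewrite cubicBE cz.
  have -> : z ^+ 2 * a = a ^+ 3.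
    transitivity (a * z * z); first by ring.
    by rewrite az -mulrA az; ring.
  have -> : z * a ^+ 2 = a ^+ 3 by rewrite mulrC.
  move=> e; apply: (mulfI F2); apply/eqP; rewrite -subr_eq0 -[X in _ == X]e.
  by apply/eqP; ring.
have := square_moment cz ca qz qa E; rewrite a2z a2z2 [rho * _]mulrC => e.
by rewrite -e; ring.
Qed.

Lemma br_mul_translate s t u v x y :
  (forall y, br (s * y) = u * br y) -> (forall y, br (t * y) = v * br y) ->
  br 1 = 0 -> br x = 0 -> br y = 0 -> br ((x + s) * (y + t)) = br (x * y).
Proof.
move=> brs brt b1 bx b_y.
have -> : (x + s) * (y + t) = x * y + s * y + t * x + s * (t * 1) by ring.
by rewrite !brD !brs !brt b1 bx b_y; ring.
Qed.

Lemma br_add2 x y : br (x + 2 * y) = br x + 2 * br y.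
Proof. by rewrite brD br_nat. Qed.

Lemma br_sqr_add2 x y :
  br ((x + 2 * y) ^+ 2) = br (x ^+ 2) + 4 * br (x * y) + 4 * br (y * y).
Proof.
have -> : (x + 2 * y) ^+ 2 = x ^+ 2 + 4%:R * (x * y) + 4%:R * (y * y) by ring.
by rewrite !brD !br_nat.
Qed.

(** The correction is t (3 <x^2> - <rho>). On a signed weight <x^2> is the number of weights, so it
    vanishes by (W5); the same bracket governs the t^2 term of [quartic_translate]. *)
Lemma cubic_translate s t x : (forall y, br (s * y) = t * br y) ->
  br 1 = 0 -> br x = 0 ->
  cubic (x + s) = cubic x + 3 * t * br (x ^+ 2) - t * br rho.
Proof.
move=> brs b1 bx; rewrite /cubic.
have -> : (x + s) ^+ 3 = x ^+ 3 + 3%:R * (s * x ^+ 2)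
    + 3%:R * (s * (s * x)) + s * (s * (s * 1)) by ring.
by rewrite mulrDr [rho * s]mulrC !brD !br_nat !brs b1 bx; ring.
Qed.

Lemma quartic_translate C s t x : (forall y, br (s * y) = t * br y) ->
  br 1 = 0 -> br x = 0 ->
  quartic C (x + s) = quartic C x + 60 * t * cubic x
    + 90 * t ^+ 2 * br (x ^+ 2) - 30 * t ^+ 2 * br rho.
Proof.
move=> brs b1 bx; rewrite /quartic /cubic.
have -> : (x + s) ^+ 4 = x ^+ 4 + 4%:R * (s * x ^+ 3)
    + 6%:R * (s * (s * x ^+ 2)) + 4%:R * (s * (s * (s * x)))
    + s * (s * (s * (s * 1))) by ring.
have -> : (x + s) ^+ 2 * rho = x ^+ 2 * rho + 2%:R * (s * (rho * x))
    + s * (s * rho) by ring.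
by rewrite !brD !br_nat !brs b1 bx; ring.
Qed.

(** If [e] is false, then <(z + 2a)^2> = <z^2> + 8, so [cubic] grows by 24 t and [quartic] by 60 t
    [cubic] + 720 t^2; these match because 4 * 720 = 5 * 24^2. If [e] is true, <(z + 2a)^2> = <z^2>
    and nothing changes. *)
Lemma quartic_cubic_translate C s t a z (e : bool) :
  (forall y, br (s * y) = t * br y) -> br 1 = 0 -> br z = 0 -> br a = 0 ->
  br rho = 3 * br (z ^+ 2) -> br (z * a) = (-1) ^+ e -> br (a * a) = 1 ->
  (e -> cubic (z + 2 * a) = 0) ->
  4 * quartic C (z + 2 * a) = 5 * cubic (z + 2 * a) ^+ 2 ->
  4 * quartic C (z + 2 * a + s) = 5 * cubic (z + 2 * a + s) ^+ 2.
Proof.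
move=> brs b1 bz ba brho za aa ce W8.
have bx : br (z + 2 * a) = 0 by rewrite br_add2 bz ba mulr0 addr0.
rewrite (cubic_translate brs b1 bx) (quartic_translate _ brs b1 bx).
rewrite br_sqr_add2 brho za aa; case: e ce {za} => [/(_ isT) | _]; last first.
  move: W8; move: (cubic _) (quartic _ _) => c q.
  by rewrite !mulrDr expr0 => ->; ring.
move=> c0; move: W8; rewrite c0; move: (quartic _ _) => q.
by rewrite !mulrDr expr1 => ->; ring.
Qed.

Lemma cubicN x : cubic (- x) = - cubic x.
Proof.
rewrite /cubic mulrN (_ : (- x) ^+ 3 = - x ^+ 3); last by ring.
by rewrite !brN opprB opprK addrC.
Qed.

Lemma quarticN C x : quartic C (- x) = quartic C x.
Proof.
rewrite /quartic sqrrN (_ : (- x) ^+ 4 = x ^+ 4) //; ring.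
Qed.

(** A converse of [isolated_moments] for one weight: at 3a the forms take the values 720 <a^3>^2 and
    24 <a^3>, the fourth moment having cancelled. *)
Lemma single_weight_moment C a : cubic a = 0 -> quartic C a = 0 ->
  br (a ^+ 2 * rho) = 5 * br (a ^+ 4) - 3 * br (a ^+ 3) ^+ 2 ->
  4 * quartic C (a + 2 * a) = 5 * cubic (a + 2 * a) ^+ 2.
Proof.
move=> ca qa aE; rewrite quarticDE cubicDE qa ca.
have -> : br (rho * a) = br (a ^+ 3).
  by apply/esym/eqP; rewrite -subr_eq0 -/(cubic a) ca.
have -> : a ^+ 3 * a = a ^+ 4 by ring.
have -> : a ^+ 2 * a ^+ 2 = a ^+ 4 by ring.
have -> : a * a ^+ 3 = a ^+ 4 by ring.
have -> : a ^+ 2 * a = a ^+ 3 by ring.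
have -> : a * a ^+ 2 = a ^+ 3 by ring.
have -> : a * a * rho = a ^+ 2 * rho by ring.
by rewrite aE; ring.
Qed.

Lemma br_mul_affine s t r u v q x y z :
  (forall x, br (s * x) = u * br x) -> (forall x, br (t * x) = v * br x) ->
  (forall x, br (r * x) = q * br x) ->
  br (x * (s * y + t * z + r)) = u * br (x * y) + v * br (x * z) + q * br x.
Proof.
move=> brs brt brr.
have -> : x * (s * y + t * z + r) = s * (x * y) + t * (x * z) + r * x by ring.
by rewrite !brD brs brt brr.
Qed.

End AdditiveFunctional.

(** * Multiplication in an orthonormal frame *)

Section Frame.

Variables (F : fieldType) (H : comPzRingType) (br : H -> F) (sc : F -> H).
Variables (K : finType) (w : K -> H).
Hypothesis brD : {morph br : x y / x + y}.
Hypotheses (scD : {morph sc : a b / a + b}) (scM : {morph sc : a b / a * b}).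
Hypotheses (sc1 : sc 1 = 1) (br_sc : forall s x, br (sc s * x) = s * br x).
Hypotheses (br1 : br 1 = 0) (brw : forall k, br (w k) = 0).
Hypothesis brww : forall k l, br (w k * w l) = (k == l)%:R.

Lemma sc0 : sc 0 = 0.
Proof. by apply: (addrI (sc 0)); rewrite -scD !addr0. Qed.

Lemma br_scalar s : br (sc s) = 0.
Proof. by rewrite -[sc s]mulr1 br_sc br1 mulr0. Qed.

Lemma scalar_inj (k : K) : injective sc.
Proof.
move=> a b /(congr1 (fun x => br (x * (w k * w k)))).
by rewrite !br_sc brww eqxx !mulr1.
Qed.

Definition frame_comb y (q : F * F * {ffun K -> F}) : H :=
  sc q.1.1 + sc q.1.2 * y + \sum_k sc (q.2 k) * w k.

Lemma br_frame_comb y q : br y = 0 -> br (frame_comb y q) = 0.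
Proof.
move=> y0; rewrite !brD br_scalar br_sc y0 mulr0 !add0r.
rewrite (big_morph br brD (br0 brD)) big1 // => l _.
by rewrite br_sc brw mulr0.
Qed.

(** Pairing with [w m] reads off the coefficient of [w m]. What is left is a relation between 1 and
    [y], which would make [y] a scalar unless it is trivial. *)
Lemma frame_comb_inj (k : K) y :
  (forall k, br (y * w k) = 0) -> (forall b, y <> sc b) ->
  injective (frame_comb y).
Proof.
move=> yw ynsc.
have comb_w q m : br (frame_comb y q * w m) = q.2 m.
  rewrite !mulrDl !brD br_sc brw mulr0 -mulrA br_sc yw mulr0 !add0r mulr_suml.
  rewrite (big_morph br brD (br0 brD)) (bigD1 m) //=.
  rewrite -mulrA br_sc brww eqxx mulr1 big1 ?addr0 // => l lm.
  by rewrite -mulrA br_sc brww (negbTE lm) mulr0.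
move=> [[a b] c] [[a' b'] c'] E.
have cE : c = c'.
  by apply/ffunP => m; have := comb_w ((a, b), c) m; rewrite E comb_w.
move: E; rewrite cE /frame_comb /= => /addIr E.
have [bE | bN] := eqVneq b b'.
  by move: E; rewrite bE => /addIr /(scalar_inj k) ->.
case: (ynsc ((b - b')^-1 * (a' - a))).
suff E' : sc (b - b') * y = sc (a' - a).
  by rewrite scM -E' mulrA -scM mulVf ?sc1 ?mul1r // subr_eq0.
apply: (addrI (sc a + sc b' * y)).
have {1}-> : sc (b - b') * y = sc b * y - sc b' * y.
  by rewrite -[in RHS](subrK b' b) [in RHS]scD [in RHS]mulrDl addrK.
have -> : sc (a' - a) = sc a' - sc a.
  by rewrite -[in RHS](subrK a a') [in RHS]scD addrK.
transitivity (sc a + sc b * y); first by ring.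
by rewrite E; ring.
Qed.

Variable t : K -> K -> F.
Hypothesis tE : forall k l, br (w k ^+ 2 * w l) = t k l.
Hypothesis brwww :
  forall k l m, k != l -> k != m -> l != m -> br (w k * w l * w m) = 0.
Hypothesis brwwww :
  forall k l m, l != m -> br (w k ^+ 2 * (w l * w m)) = t k l * t k m.
Hypothesis orthogonal_scalar :
  forall y, br y = 0 -> (forall k, br (y * w k) = 0) -> exists b, y = sc b.

(** The coefficients of [w k] and [w l] are the pairings of the product with these weights, so the
    remainder is orthogonal to 1 and to the whole frame, hence a scalar [b]. *)
Lemma frame_mulE k l : k != l ->
  w k * w l = sc (t k l) * w k + sc (t l k) * w l + sc (- (t k l * t l k)).
Proof.
move=> kl; have lk : l != k by rewrite eq_sym.
have kkl : br (w k * w l * w k) = t k l by rewrite -tE; congr br; ring.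
have kll : br (w k * w l * w l) = t l k by rewrite -tE; congr br; ring.
have [||b Eb] := orthogonal_scalar
    (y := w k * w l - (sc (t k l) * w k + sc (t l k) * w l)).
- rewrite (brB brD) brww (negbTE kl) brD !br_sc !brw.
  by rewrite !mulr0 addr0 subr0.
- move=> m; rewrite mulrBl (brB brD) mulrDl brD -![sc _ * _ * _]mulrA !br_sc.
  rewrite !brww.
  have [<-|km] := eqVneq k m.
    by rewrite kkl (negbTE lk) mulr1 mulr0 addr0 subrr.
  have [<-|lm] := eqVneq l m; first by rewrite kll mulr0 mulr1 add0r subrr.
  by rewrite brwww // !mulr0 addr0 subr0.
have E : w k * w l = sc (t k l) * w k + sc (t l k) * w l + sc b.
  by rewrite -Eb addrC subrK.
(* [brwwww] asks only that its last two indices differ, so the squared weight may be one of them;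
   this determines [b]. *)
have := brwwww k kl; rewrite E.
rewrite (br_mul_affine brD _ _ _ (br_sc _) (br_sc _) (br_sc _)) !tE expr2 brww
  eqxx.
rewrite mulr1 [t k k * _]mulrC -addrA -[RHS]addr0 => /addrI /eqP.
by rewrite addrC addr_eq0 => /eqP ->; rewrite [t l k * _]mulrC.
Qed.

Lemma frame_mul0 k l : k != l ->
  (w k + sc (- t l k)) * (w l + sc (- t k l)) = 0.
Proof.
move=> kl; rewrite mulrDl !mulrDr frame_mulE // -scM mulrNN.
have scN a : sc (- a) = - sc a.
  by apply: (addrI (sc a)); rewrite -scD !subrr sc0.
by rewrite !scN !scM; ring.
Qed.

(** [br (w k ^+ 2 * (w l * w m))] is evaluated twice, by [brwwww] and by expanding [w l * w m]; the
    difference of the results factors. *)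
Lemma frame_tree k l m : k != l -> k != m -> l != m ->
  (t k l == t m l) || (t k m == t l m).
Proof.
move=> kl km lm; rewrite -subr_eq0 -(subr_eq0 (t k m)) -mulf_eq0.
have := brwwww k lm; rewrite frame_mulE //.
rewrite (br_mul_affine brD _ _ _ (br_sc _) (br_sc _) (br_sc _)) !tE expr2 brww
  eqxx mulr1.
by move=> E; rewrite mulrBl !mulrBr -E; apply/eqP; ring.
Qed.

Lemma frame_isolated : (1 < #|K|)%N -> exists k (s : K -> F),
  forall l, l != k -> (w k + sc (s k)) * (w l + sc (s l)) = 0.
Proof.
move=> K1; have [k leaf] := exists_leaf K1 frame_tree.
have /card_gt1P[a [b [_ _ ab]]] := K1.
have [l0 l0k] : exists l0, l0 != k.
  by have [E|] := eqVneq a k; [exists b; rewrite -E eq_sym | exists a].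
(* At a leaf [t l k] has the same value for all [l], so one shift of [w k] fits every instance of
   [frame_mul0]. *)
exists k, (fun l => if l == k then - t l0 k else - t k l) => l lk.
by rewrite eqxx (negbTE lk) (leaf l0 l) // frame_mul0 // eq_sym.
Qed.

(** The two coefficients make the difference [y] of the sides orthogonal to 1 and [w k]. Being a
    multiple of [w k], it is killed by the other weights, so it is a scalar b, and b = <y w_l^2> =
    0. *)
Lemma isolated_ideal (k l : K) : l != k ->
  (forall m, m != k -> w k * w m = 0) ->
  forall h, w k * h = sc (br (w k * h)) * (w k * w k)
    + sc (br (w k * w k * h) - br (w k ^+ 3) * br (w k * h)) * w k.
Proof.
move=> lk kill h; set A := br (w k * h); set B := br (w k * w k * h) - _.
apply/eqP; rewrite -subr_eq0; apply/eqP.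
have -> : w k * h - (sc A * (w k * w k) + sc B * w k)
    = w k * (h - sc A * w k - sc B * 1) by ring.
set y := w k * _.
have yE : y = w k * h - sc A * (w k * w k) - sc B * w k by rewrite /y; ring.
have y_l m : m != k -> y * w m = 0.
  by move=> mk; rewrite /y mulrAC kill // mul0r.
have [||b Eb] := orthogonal_scalar (y := y).
- by rewrite yE !(brB brD) !br_sc brww brw eqxx mulr1 mulr0 subr0 subrr.
- move=> m; have [->|mk] := eqVneq m k; last by rewrite y_l // (br0 brD).
  have -> : y * w k
      = w k * w k * h - sc A * (w k ^+ 3) - sc B * (w k * w k).
    by rewrite yE; ring.
  by rewrite !(brB brD) !br_sc brww eqxx mulr1 /B; ring.
have : br (y * w l * w l) = b by rewrite Eb -mulrA br_sc brww eqxx mulr1.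
by rewrite y_l // mul0r (br0 brD) Eb => <-; exact: sc0.
Qed.

End Frame.

(** * Transport and additivity of the cubic and quartic forms *)

Section Morphism.

Variables (F : fieldType) (H' H : comPzRingType) (f : H' -> H).
Variables (br' : H' -> F) (br : H -> F) (rho' : H') (rho : H).
Hypotheses (fM : {morph f : x y / x * y}) (f_rho : f rho' = rho).
Hypothesis brE : forall x, br' x = br (f x).

(** [f] is a bare multiplicative map, so powers are unfolded into products before [fM] applies. *)
Let x2 (R : comPzRingType) (x : R) : x ^+ 2 = x * x. Proof. by ring. Qed.
Let x3 (R : comPzRingType) (x : R) : x ^+ 3 = x * x * x. Proof. by ring. Qed.
Let x4 (R : comPzRingType) (x : R) : x ^+ 4 = x * x * x * x.
Proof. by ring. Qed.

Lemma cubic_morph x : cubic br' rho' x = cubic br rho (f x).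
Proof. by rewrite /cubic !x3 !brE !fM f_rho. Qed.

Lemma quartic_morph C x : quartic br' rho' C x = quartic br rho C (f x).
Proof. by rewrite /quartic !x4 !x2 !brE !fM f_rho. Qed.

End Morphism.

Section Gluing.

Variables (F : fieldType) (H1 H2 H : comPzRingType).
Variables (br1 : H1 -> F) (br2 : H2 -> F) (br : H -> F).
Variables (rho1 : H1) (rho2 : H2) (rho : H).
Variables (agree : H1 -> H2 -> Prop) (glue : H1 -> H2 -> H).
Hypothesis agreeM : forall x1 x2 y1 y2,
  agree x1 x2 -> agree y1 y2 -> agree (x1 * y1) (x2 * y2).
Hypothesis glueM : forall x1 x2 y1 y2, agree x1 x2 -> agree y1 y2 ->
  glue (x1 * y1) (x2 * y2) = glue x1 x2 * glue y1 y2.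
Hypothesis br_glue : forall x1 x2, agree x1 x2 ->
  br (glue x1 x2) = br1 x1 + br2 x2.
Hypotheses (agree_rho : agree rho1 rho2) (glue_rho : glue rho1 rho2 = rho).

Let x2 (R : comPzRingType) (x : R) : x ^+ 2 = x * x. Proof. by ring. Qed.
Let x3 (R : comPzRingType) (x : R) : x ^+ 3 = x * x * x. Proof. by ring. Qed.
Let x4 (R : comPzRingType) (x : R) : x ^+ 4 = x * x * x * x.
Proof. by ring. Qed.

Lemma cubic_glue x y : agree x y ->
  cubic br rho (glue x y) = cubic br1 rho1 x + cubic br2 rho2 y.
Proof.
move=> xy; rewrite /cubic !x3 -glue_rho -!glueM ?br_glue; auto.
by ring.
Qed.

Lemma quartic_glue C1 C2 C x y : agree x y -> C = C1 + C2 ->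
  quartic br rho C (glue x y) = quartic br1 rho1 C1 x + quartic br2 rho2 C2 y.
Proof.
move=> xy ->; rewrite /quartic !x4 !x2 -glue_rho -!glueM ?br_glue; auto 6.
by ring.
Qed.

End Gluing.

(** * Shifts *)

Section WeightData.

Variables (p : nat) (I J K : finType) (W : weight_data p I J K).
Local Notation H := (wring p I J).
Local Notation br := (bracket W).
Local Notation w := (weight W).
Implicit Types x y z : H.

Lemma bracketD : {morph br : x y / x + y}.
Proof. by move=> x y; rewrite -[x]scale1r bracket_is_linear mul1r scale1r. Qed.

Lemma bracket0 : br 0 = 0. Proof. exact: br0 bracketD. Qed.

Lemma bracketZ s x : br (s *: x) = s * br x.
Proof. by rewrite -[s *: x]addr0 bracket_is_linear bracket0 addr0. Qed.

Lemma bracket_sc s x : br (sc s * x) = s * br x.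
Proof. by rewrite -scaleE bracketZ. Qed.

Lemma bracket_sum (T : finType) (P : pred T) (f : T -> H) :
  br (\sum_(i | P i) f i) = \sum_(i | P i) br (f i).
Proof. exact: (big_morph br bracketD bracket0). Qed.

Local Notation cubicW := (cubic br (rho W)).
Local Notation quarticW :=
  (quartic br (rho W) (7 * br (rho W ^+ 2) - 4 * br (euler W ^+ 2))).

Lemma weight_systemE : weight_system W <->
  [/\ (3 <= #|I| + 2 * #|J|)%N,
      #|K| = (#|I| + 2 * #|J| - 2)%N,
      (forall i, wa W i != 0 /\ wb W i != 0) /\ (forall j, wc W j != 0) &
  [/\ br 1 = 0,
      forall k, br (w k) = 0,
      forall k l, br (w k * w l) = (k == l)%:R &
  [/\ br (rho W) = (3 * #|K|)%:R,
      forall eps, cubicW (signed_weight W eps) = 0,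
      forall eps, quarticW (signed_weight W eps) = 0 &
      forall k eps, 4 * quarticW (signed_weight W eps + 2 * w k)
        = 5 * cubicW (signed_weight W eps + 2 * w k) ^+ 2]]].
Proof.
have q1 x : quarticW x = 15 * br (x ^+ 4) - 30 * br (x ^+ 2 * rho W)
    + 7 * br (rho W ^+ 2) - 4 * br (euler W ^+ 2).
  by rewrite /quartic addrA.
have q4 x : 4 * quarticW x = 60 * br (x ^+ 4) - 120 * br (x ^+ 2 * rho W)
    + 28 * br (rho W ^+ 2) - 16 * br (euler W ^+ 2).
  exact: mul4_quartic.
have xE k eps : 2 *: w k + signed_weight W eps = signed_weight W eps + 2 * w k.
  by rewrite addrC scaler_nat mulr_natl.
split=> -[c1 c2 nz [b1 bw orth [brho W6 W7 W8]]].
  split; [exact: c1 | exact: c2 | exact: nz | split].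
  - exact: b1.
  - exact: bw.
  - exact: orth.
  split; [exact: brho | exact: W6 | |].
  - by move=> eps; rewrite q1; exact: W7.
  - by move=> k eps; rewrite q4 -xE; exact: W8.
split; [exact: c1 | exact: c2 | exact: nz | split].
- exact: b1.
- exact: bw.
- exact: orth.
split; [exact: brho | exact: W6 | |].
- by move=> eps x; rewrite -q1; exact: W7.
- by move=> k eps x; rewrite -q4 /x xE; exact: W8.
Qed.

Definition flip k (eps : K -> bool) : K -> bool :=
  fun j => if j == k then ~~ eps j else eps j.

(** For [eps k] true, the argument of (W8) is itself a signed weight, at which both forms vanish. *)
Lemma signed_weight_flip k eps : signed_weight W (flip k eps)
  = if eps k then signed_weight W eps + 2 * w k
    else signed_weight W eps - 2 * w k.
Proof.
have E e : signed_weight W e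
    = (-1) ^+ e k *: w k + \sum_(j | j != k) (-1) ^+ e j *: w j.
  by rewrite /signed_weight (bigD1 k).
have -> : signed_weight W (flip k eps)
    = (-1) ^+ (~~ eps k) *: w k + \sum_(j | j != k) (-1) ^+ eps j *: w j.
  rewrite E {1}/flip eqxx; congr (_ + _).
  by apply: eq_bigr => j /negbTE jk; rewrite /flip jk.
rewrite E; move: (\sum_(_ | _) _) (w k) => y x.
case: (eps k); rewrite expr0 expr1 scaleN1r scale1r; ring.
Qed.

Lemma signed_weightN eps :
  signed_weight W (fun k => ~~ eps k) = - signed_weight W eps.
Proof.
rewrite /signed_weight -sumrN; apply: eq_bigr => k _.
by case: (eps k); rewrite /= ?expr1 ?expr0 !scaleN1r ?scale1r ?opprK.
Qed.

End WeightData.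

Section WeightSystem.

Variables (p : nat) (I J K : finType) (W : weight_data p I J K).
Local Notation H := (wring p I J).
Local Notation br := (bracket W).
Local Notation w := (weight W).
Implicit Types x y z : H.
Hypothesis orth : forall k l, br (w k * w l) = (k == l)%:R.

Lemma bracket_signed_weight_mul eps k :
  br (signed_weight W eps * w k) = (-1) ^+ eps k.
Proof.
rewrite /signed_weight mulr_suml bracket_sum (bigD1 k) //= big1 => [|l lk];
  rewrite scaleE -mulrA bracket_sc orth ?eqxx ?mulr1 ?addr0 //.
by rewrite (negbTE lk) mulr0.
Qed.

Lemma bracket_signed_weight_sqr eps :
  br (signed_weight W eps ^+ 2) = #|K|%:R.
Proof.
rewrite expr2 {2}/signed_weight mulr_sumr bracket_sum.
rewrite (eq_bigr (fun=> 1)) ?sumr_const // => k _.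
rewrite scaleE mulrCA bracket_sc bracket_signed_weight_mul.
by case: (eps k); rewrite ?mulrNN mul1r.
Qed.

End WeightSystem.

Section Shift.

Variables (p : nat) (I J K : finType) (W : weight_data p I J K).
Variable s : K -> 'F_p.
Local Notation H := (wring p I J).
Local Notation br := (bracket W).
Local Notation w := (weight W).

Lemma signed_weight_shift eps : signed_weight (shift W s) eps
  = signed_weight W eps + sc (\sum_k (-1) ^+ eps k * s k).
Proof.
rewrite /signed_weight scE scaler_suml -big_split; apply: eq_bigr => k _ /=.
by rewrite scalerDr scalerA.
Qed.

Lemma shift_weight_system : weight_system W -> weight_system (shift W s).
Proof.
move=> /weight_systemE[c1 c2 nz [b1 bw orth [brho W6 W7 W8]]].
have bD := bracketD W.
have bsc t y : br (sc t * y) = t * br y by exact: bracket_sc.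
have bsc1 t : br (sc t) = 0 by rewrite -[sc t]mulr1 bsc b1 mulr0.
have bz eps : br (signed_weight W eps) = 0.
  rewrite /signed_weight bracket_sum big1 // => k _.
  by rewrite bracketZ bw mulr0.
have wE k : weight (shift W s) k = w k + sc (s k) by rewrite scE.
have brE : bracket (shift W s) = br by [].
have rhoE : rho (shift W s) = rho W by [].
have eulerE : euler (shift W s) = euler W by [].
apply/weight_systemE; rewrite brE rhoE eulerE.
split; [exact: c1 | exact: c2 | exact: nz | split; [exact: b1 | | | split]].
- by move=> k; rewrite wE bD bw bsc1 addr0.
- move=> k l; rewrite !wE -orth.
  exact: (br_mul_translate bD (bsc _) (bsc _) b1 (bw k) (bw l)).
- exact: brho.
- move=> eps; rewrite signed_weight_shift.
  rewrite (cubic_translate bD _ (bsc _) b1 (bz _)) W6.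
  by rewrite bracket_signed_weight_sqr // brho natrM; ring.
- move=> eps; rewrite signed_weight_shift.
  rewrite (quartic_translate bD _ _ (bsc _) b1 (bz _)) W6 W7.
  by rewrite bracket_signed_weight_sqr // brho natrM; ring.
move=> k eps.
have -> : signed_weight (shift W s) eps + 2 * weight (shift W s) k
  = signed_weight W eps + 2 * w k
    + sc (\sum_k (-1) ^+ eps k * s k + 2 * s k).
  rewrite signed_weight_shift wE scD scM.
  have -> : sc (2 : 'F_p) = 2 :> H by rewrite scD !sc1.
  by move: (signed_weight _ _) (w k) (sc _) (sc _) => x1 x2 x3 x4; ring.
apply: (quartic_cubic_translate bD (bsc _) b1 (bz eps) (bw k) _
  (bracket_signed_weight_mul orth eps k)).
- by rewrite bracket_signed_weight_sqr // brho natrM.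
- by rewrite orth eqxx.
(* With sign -1 at [k], adding [2 * w k] flips the sign, and (W6) applies. *)
- by move=> ek; move: (W6 (flip k eps)); rewrite signed_weight_flip ek.
- exact: W8.
Qed.

End Shift.

(** * Products of weights *)

Section Products.

Variables (p : nat) (I J K : finType) (W : weight_data p I J K).
Hypotheses (pp : prime p) (p7 : (7 <= p)%N) (HW : weight_system W).
Local Notation H := (wring p I J).
Local Notation br := (bracket W).
Local Notation w := (weight W).

Let F2 : 2%:R != 0 :> 'F_p. Proof. exact: Fp_nat_neq0. Qed.
Let F3 : 3%:R != 0 :> 'F_p. Proof. exact: Fp_nat_neq0. Qed.
Let F5 : 5%:R != 0 :> 'F_p. Proof. exact: Fp_nat_neq0. Qed.
Let brD := bracketD W.
Let br_sc s x : br (sc s * x) = s * br x. Proof. exact: bracket_sc. Qed.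

Lemma bracket1 : br 1 = 0.
Proof. by case/weight_systemE: HW => _ _ _ []. Qed.

Lemma bracket_weight k : br (w k) = 0.
Proof. by case/weight_systemE: HW => _ _ _ []. Qed.

Lemma bracket_weight2 k l : br (w k * w l) = (k == l)%:R.
Proof. by case/weight_systemE: HW => _ _ _ []. Qed.

Lemma card_weights : #|K| = (#|I| + 2 * #|J| - 2)%N.
Proof. by case: HW. Qed.

Lemma card_index_ge3 : (3 <= #|I| + 2 * #|J|)%N.
Proof. by case: HW. Qed.

Let W6 eps : cubic br (rho W) (signed_weight W eps) = 0.
Proof. by case/weight_systemE: HW => _ _ _ [_ _ _ []]. Qed.

Let W7 eps : quartic br (rho W)
  (7 * br (rho W ^+ 2) - 4 * br (euler W ^+ 2)) (signed_weight W eps) = 0.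
Proof. by case/weight_systemE: HW => _ _ _ [_ _ _ []]. Qed.

Let W8 k eps : 4 * quartic br (rho W)
  (7 * br (rho W ^+ 2) - 4 * br (euler W ^+ 2)) (signed_weight W eps + 2 * w k)
  = 5 * cubic br (rho W) (signed_weight W eps + 2 * w k) ^+ 2.
Proof. by case/weight_systemE: HW => _ _ _ [_ _ _ []]. Qed.

Let flipE k l (e : K -> bool) : l != k -> flip k e l = e l.
Proof. by rewrite /flip => /negbTE ->. Qed.

Let weight_flip k (e : K -> bool) : e k = false ->
  signed_weight W (flip k e) = signed_weight W e - 2 * w k.
Proof. by move=> ek; rewrite signed_weight_flip ek. Qed.

Lemma bracket_weight3 k l m : k != l -> k != m -> l != m ->
  br (w k * w l * w m) = 0.
Proof.
move=> kl km lm; pose e : K -> bool := fun=> false.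
have lk : l != k by rewrite eq_sym.
have mk : m != k by rewrite eq_sym.
have ml : m != l by rewrite eq_sym.
have Ek : signed_weight W (flip k e) = signed_weight W e - 2 * w k.
  exact: weight_flip.
have El : signed_weight W (flip l e) = signed_weight W e - 2 * w l.
  exact: weight_flip.
have Em : signed_weight W (flip m e) = signed_weight W e - 2 * w m.
  exact: weight_flip.
have Ekl : signed_weight W (flip l (flip k e))
    = signed_weight W e - 2 * w k - 2 * w l.
  by rewrite weight_flip ?Ek; [exact: erefl | rewrite !flipE].
have Ekm : signed_weight W (flip m (flip k e))
    = signed_weight W e - 2 * w k - 2 * w m.
  by rewrite weight_flip ?Ek; [exact: erefl | rewrite !flipE].
have Elm : signed_weight W (flip m (flip l e))
    = signed_weight W e - 2 * w l - 2 * w m.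
  by rewrite weight_flip ?El; [exact: erefl | rewrite !flipE].
have Eklm : signed_weight W (flip m (flip l (flip k e)))
    = signed_weight W e - 2 * w k - 2 * w l - 2 * w m.
  by rewrite weight_flip ?Ekl; [exact: erefl | rewrite !flipE].
apply: (cubic_third_difference brD F2 F3 (rho := rho W)
  (z := signed_weight W e)).
- exact: W6.
- by rewrite -Ek; exact: W6.
- by rewrite -El; exact: W6.
- by rewrite -Em; exact: W6.
- by rewrite -Ekl; exact: W6.
- by rewrite -Ekm; exact: W6.
- by rewrite -Elm; exact: W6.
- by rewrite -Eklm; exact: W6.
Qed.

(** [square_moment] needs z - 2 w_k to be a signed weight, that is, sign +1 at [k]. As both sides
    are even in the signed weight, the other sign follows by negating all signs. *)
Lemma weight_square_moment k eps :
  3 * br (w k ^+ 2 * signed_weight W eps ^+ 2)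
    + (2 * br (w k ^+ 4) - br (w k ^+ 2 * rho W))
  = 3 * br (w k ^+ 2 * signed_weight W eps) ^+ 2.
Proof.
have even e : e k = false -> 3 * br (w k ^+ 2 * signed_weight W e ^+ 2)
    + (2 * br (w k ^+ 4) - br (w k ^+ 2 * rho W))
    = 3 * br (w k ^+ 2 * signed_weight W e) ^+ 2.
  move=> ek; rewrite addrA.
  apply: (square_moment brD F2 F3 F5 (W6 e) _ (W7 e) _ (W8 k e)).
    by rewrite -weight_flip //; exact: W6.
  by rewrite -weight_flip //; exact: W7.
case ek: (eps k); last exact: even.
have := even (fun j => ~~ eps j); rewrite ek signed_weightN => /(_ erefl).
by rewrite sqrrN mulrN (brN brD) sqrrN.
Qed.

Definition weight_mult k l := br (w k ^+ 2 * w l).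
Local Notation t := weight_mult.

(** [k] may be [l] or [m]; some of the four sign vectors then have sign -1 at [k], which
    [weight_square_moment] allows. *)
Lemma bracket_weight4 k l m : l != m ->
  br (w k ^+ 2 * (w l * w m)) = t k l * t k m.
Proof.
move=> lm; pose e : K -> bool := fun=> false.
have ml : m != l by rewrite eq_sym.
have El : signed_weight W (flip l e) = signed_weight W e - 2 * w l.
  exact: weight_flip.
have Em : signed_weight W (flip m e) = signed_weight W e - 2 * w m.
  exact: weight_flip.
have Elm : signed_weight W (flip m (flip l e))
    = signed_weight W e - 2 * w l - 2 * w m.
  by rewrite weight_flip ?El; [exact: erefl | rewrite !flipE].
apply: (square_moment_bilinear brD F2 F3
  (Q := 2 * br (w k ^+ 4) - br (w k ^+ 2 * rho W)) (z := signed_weight W e)).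
- exact: weight_square_moment.
- by rewrite -El; exact: weight_square_moment.
- by rewrite -Em; exact: weight_square_moment.
- by rewrite -Elm; exact: weight_square_moment.
Qed.

(* The vectors 1, w k and a hypothetical non-scalar y would be |K| + 2
   independent vectors, hence span H; but all of them are orthogonal to 1. *)
Lemma orthogonal_scalar (k0 : K) (y : H) :
  br y = 0 -> (forall k, br (y * w k) = 0) -> exists b, y = sc b.
Proof.
move=> y0 yw.
have [/existsP[b /eqP->]|] := boolP [exists b, y == sc b]; first by exists b.
rewrite negb_exists => /forallP ynsc; exfalso.
have f_inj : injective (frame_comb sc w y).
  apply: (frame_comb_inj brD (@scD _ _ _) (@scM _ _ _) (sc1 _ _ _) br_sc
    bracket_weight bracket_weight2 k0 yw) => b E.
  by have := ynsc b; rewrite E eqxx.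
(* Over a finite field counting replaces a dimension argument: both sides are p^(|K| + 2), so the
   injection is onto and reaches [w k0 * w k0], whose bracket is 1. *)
have cards : (#|{: H}| <= #|{: 'F_p * 'F_p * {ffun K -> 'F_p}}|)%N.
  rewrite card_wring // !card_prod card_ffun (card_Fp pp) card_weights.
  rewrite mulnn -expnD leq_exp2l ?prime_gt1 //.
  by have := card_index_ge3; lia.
have /codomP[q Eq] := inj_card_onto f_inj cards (w k0 * w k0).
have := bracket_weight2 k0 k0; rewrite Eq.
rewrite (br_frame_comb brD br_sc bracket1 bracket_weight) // eqxx => /eqP.
by rewrite eq_sym oner_eq0.
Qed.

Lemma exists_isolated : (1 < #|K|)%N -> exists k (s : K -> 'F_p),
  forall l, l != k -> weight (shift W s) k * weight (shift W s) l = 0.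
Proof.
move=> K1; have /card_gt1P[k0 _] := K1.
exact: (frame_isolated brD (@scD _ _ _) (@scM _ _ _) br_sc
  bracket_weight bracket_weight2 (fun k l => erefl (weight_mult k l))
  bracket_weight3 bracket_weight4 (orthogonal_scalar k0) K1).
Qed.

Section Isolated.

Variable k : K.
Hypotheses (K1 : (1 < #|K|)%N) (kill : forall l, l != k -> w k * w l = 0).

Lemma isolated_mul h : w k * h = sc (br (w k * h)) * (w k * w k)
    + sc (br (w k * w k * h) - br (w k ^+ 3) * br (w k * h)) * w k.
Proof.
have [l lk] : exists l, l != k.
  have /card_gt1P[a [b [_ _ ab]]] := K1.
  by have [E|] := eqVneq a k; [exists b; rewrite -E eq_sym | exists a].
exact: (isolated_ideal brD (@scD _ _ _) br_sc bracket_weight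
  bracket_weight2 (orthogonal_scalar k) lk kill).
Qed.

Lemma isolated_rho :
  br (rho W * w k) = br (w k ^+ 3) /\
  br (rho W * w k ^+ 2) = 5 * br (w k ^+ 4) - 3 * br (w k ^+ 3) ^+ 2.
Proof.
pose e : K -> bool := fun=> false.
have zE : w k * (signed_weight W e - w k) = 0.
  apply/eqP; rewrite mulrBr subr_eq0; apply/eqP.
  rewrite /signed_weight mulr_sumr (bigD1 k) //= big1 => [|l lk].
    by rewrite addr0 scale1r.
  by rewrite scale1r kill.
apply: (isolated_moments brD F2 F3 F5 zE (W6 e) _ (W7 e) _ (W8 k e)).
  by rewrite -weight_flip; [exact: W6 | exact: erefl].
by rewrite -weight_flip; [exact: W7 | exact: erefl].
Qed.

End Isolated.

End Products.

(** * The support of an isolated weight *)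

(* The coordinates of H are abstracted, as computations in the concrete ring are
   slow. *)
Section Support.

Variables (F : fieldType) (H : comPzRingType) (I J : finType).
Variables (sc : F -> H) (pt : H -> I -> F) (sv st : H -> J -> F).
Variable mkw : (I -> F) -> (J -> F) -> (J -> F) -> H.
Hypotheses (ptM : forall x y i, pt (x * y) i = pt x i * pt y i)
  (svM : forall x y j, sv (x * y) j = sv x j * sv y j)
  (stM : forall x y j, st (x * y) j = sv x j * st y j + st x j * sv y j)
  (ptD : forall x y i, pt (x + y) i = pt x i + pt y i)
  (svD : forall x y j, sv (x + y) j = sv x j + sv y j)
  (stD : forall x y j, st (x + y) j = st x j + st y j)
  (pt_sc : forall s i, pt (sc s) i = s) (sv_sc : forall s j, sv (sc s) j = s)
  (sc1 : sc 1 = 1) (st_sc : forall s j, st (sc s) j = 0)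
  (pt_mkw : forall f u v i, pt (mkw f u v) i = f i)
  (sv_mkw : forall f u v j, sv (mkw f u v) j = u j)
  (st_mkw : forall f u v j, st (mkw f u v) j = v j).

Variables (br : H -> F) (e : I -> F) (c d : J -> F).
Hypothesis bracketE : forall y, br y = \sum_i pt y i / e i
  - \sum_j d j * sv y j / c j ^+ 2 + \sum_j st y j / c j.
Hypotheses (e0 : forall i, e i != 0) (c0 : forall j, c j != 0).
Implicit Types x y h : H.

Definition point_unit i :=
  mkw (fun q => (q == i)%:R) (fun=> 0) (fun=> 0).
Definition tau_unit j :=
  mkw (fun=> 0) (fun=> 0) (fun q => (q == j)%:R).
Definition surface_unit j :=
  mkw (fun=> 0) (fun q => (q == j)%:R) (fun=> 0).

Lemma bracket_point_unit y i : br (y * point_unit i) = pt y i / e i.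
Proof.
rewrite bracketE (sum_single (i := i)) => [|q qi]; last first.
  by rewrite ptM pt_mkw (negbTE qi) mulr0 mul0r.
rewrite !big1 => [|j _|j _].
- by rewrite ptM pt_mkw eqxx mulr1 subr0 addr0.
- by rewrite stM sv_mkw st_mkw !mulr0 addr0 mul0r.
- by rewrite svM sv_mkw !mulr0 mul0r.
Qed.

Lemma bracket_tau_unit y j : br (y * tau_unit j) = sv y j / c j.
Proof.
rewrite bracketE [X in _ + X](sum_single (i := j)) => [|q qj]; last first.
  by rewrite stM st_mkw sv_mkw (negbTE qj) !mulr0 addr0 mul0r.
rewrite !big1 => [|q _|i _].
- by rewrite stM st_mkw sv_mkw eqxx mulr1 mulr0 addr0 subr0 add0r.
- by rewrite svM sv_mkw !mulr0 mul0r.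
- by rewrite ptM pt_mkw mulr0 mul0r.
Qed.

Lemma bracket_surface_unit y j : br (y * surface_unit j)
  = st y j / c j - d j * sv y j / c j ^+ 2.
Proof.
rewrite bracketE [X in _ + X](sum_single (i := j)) => [|q qj]; last first.
  by rewrite stM st_mkw sv_mkw (negbTE qj) !mulr0 addr0 mul0r.
rewrite [X in _ - X](sum_single (i := j)) => [|q qj]; last first.
  by rewrite svM sv_mkw (negbTE qj) !mulr0 mul0r.
rewrite big1 => [|i _].
  by rewrite stM svM st_mkw sv_mkw eqxx !mulr1 mulr0 !add0r addrC.
by rewrite ptM pt_mkw mulr0 mul0r.
Qed.

Variables (x : H) (t : F).
Hypothesis xE : forall h, x * h = sc (br (x * h)) * (x * x)
    + sc (br (x * x * h) - t * br (x * h)) * x.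
Hypotheses (brx : br x = 0) (brxx : br (x * x) = 1).

Let pt_comb a b i : pt (sc a * (x * x) + sc b * x) i
  = pt x i * (a * pt x i + b).
Proof. rewrite ptD !ptM !pt_sc; move: (pt x i) => u; ring. Qed.
Let sv_comb a b j : sv (sc a * (x * x) + sc b * x) j
  = sv x j * (a * sv x j + b).
Proof. by rewrite svD !svM !sv_sc; move: (sv x j) => u; ring. Qed.
Let st_comb a b j : st (sc a * (x * x) + sc b * x) j
  = st x j * (2 * a * sv x j + b).
Proof.
by rewrite stD !stM !svM !sv_sc !st_sc; move: (sv x j) (st x j) => u v; ring.
Qed.

(** The coordinates of [xE] for [h = point_unit i], divided by the common factor [pt x i / e i]. *)
Lemma point_relations i : pt x i != 0 ->
  [/\ forall q, pt x q * (pt x q + pt x i - t) = (q == i)%:R * e i,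
      forall j, sv x j * (sv x j + pt x i - t) = 0 &
      forall j, st x j * (2 * sv x j + pt x i - t) = 0].
Proof.
move=> xi; have := xE (point_unit i).
rewrite !bracket_point_unit ptM.
set a := _ / _; set b := _ - _ => E.
have a0 : a != 0 by rewrite mulf_neq0 ?invr_eq0.
have bE : b = a * (pt x i - t) by rewrite /b /a; field; exact: e0.
split=> [q|j|j]; apply: (mulfI a0).
- transitivity (pt x q * (a * pt x q + b)); first by rewrite bE; ring.
  rewrite -pt_comb -E ptM pt_mkw.
  have [->|_] := eqVneq q i; last by rewrite !mul0r !mulr0.
  by rewrite /a mulr1 mul1r divfK.
- transitivity (sv x j * (a * sv x j + b)); first by rewrite bE; ring.
  by rewrite -sv_comb -E svM sv_mkw !mulr0.
- transitivity (st x j * (2 * a * sv x j + b)); first by rewrite bE; ring.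
  by rewrite -st_comb -E stM sv_mkw st_mkw !mulr0 addr0.
Qed.

Lemma surface_relations j : sv x j != 0 ->
  [/\ forall i, pt x i * (pt x i + sv x j - t) = 0,
      forall q, sv x q * (sv x q + sv x j - t) = 0 &
      forall q, st x q * (2 * sv x q + sv x j - t) = (q == j)%:R * c j].
Proof.
move=> xj; have := xE (tau_unit j).
rewrite !bracket_tau_unit svM.
set a := _ / _; set b := _ - _ => E.
have a0 : a != 0 by rewrite mulf_neq0 ?invr_eq0.
have bE : b = a * (sv x j - t) by rewrite /b /a; field; exact: c0.
split=> [i|q|q]; apply: (mulfI a0).
- transitivity (pt x i * (a * pt x i + b)); first by rewrite bE; ring.
  by rewrite -pt_comb -E ptM pt_mkw !mulr0.
- transitivity (sv x q * (a * sv x q + b)); first by rewrite bE; ring.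
  by rewrite -sv_comb -E svM sv_mkw !mulr0.
- transitivity (st x q * (2 * a * sv x q + b)); first by rewrite bE; ring.
  rewrite -st_comb -E stM sv_mkw st_mkw mulr0 addr0.
  have [->|_] := eqVneq q j; last by rewrite !mul0r !mulr0.
  by rewrite /a mulr1 mul1r divfK.
Qed.

(** When [sv x j = 0], pairing [x] with [tau_unit j] gives 0, so [h] is [surface_unit j]; since
    tau^2 = 0, also [x * x * h] is 0. *)
Lemma tau_relations j : sv x j = 0 -> st x j != 0 ->
  [/\ forall i, pt x i * (pt x i - t) = 0 &
      forall q, st x q * (2 * sv x q - t) = (q == j)%:R * c j].
Proof.
move=> xj vj; have := xE (surface_unit j).
have -> : br (x * x * surface_unit j) = 0.
  by rewrite bracket_surface_unit svM stM xj; ring.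
rewrite bracket_surface_unit xj mulr0 mul0r subr0 sub0r; set a := _ / _ => E.
have a0 : a != 0 by rewrite mulf_neq0 ?invr_eq0.
split=> [i|q]; apply: (mulfI a0).
- transitivity (pt x i * (a * pt x i + - (t * a))); first by ring.
  by rewrite -pt_comb -E ptM pt_mkw !mulr0.
- transitivity (st x q * (2 * a * sv x q + - (t * a))); first by ring.
  rewrite -st_comb -E stM sv_mkw st_mkw mulr0 add0r.
  have [->|_] := eqVneq q j; last by rewrite !mul0r !mulr0.
  by rewrite /a mulr1 mul1r divfK.
Qed.

(** Once a nonzero point value or constant term v is fixed, any further one equals t - v, while
    [diag] forbids a point value t / 2. This bounds the support, and <x> = 0, <x^2> = 1 rule out the
    cases that are too small. *)
Lemma isolated_support :
  [\/ exists i i', [/\ i != i', pt x i != 0, pt x i' != 0,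
        forall q, q != i -> q != i' -> pt x q = 0 &
        forall j, sv x j = 0 /\ st x j = 0],
      exists j, [/\ sv x j != 0, forall i, pt x i = 0 &
        forall q, q != j -> sv x q = 0 /\ st x q = 0] |
      exists i j, [/\ pt x i != 0, st x j != 0, forall q, q != i -> pt x q = 0,
        forall q, sv x q = 0 & forall q, q != j -> st x q = 0]].
Proof.
have diag i : pt x i != 0 -> 2 * pt x i - t != 0.
  move=> xi; case: (point_relations xi) => /(_ i) E _ _.
  apply: contraTneq (e0 i) => z; rewrite negbK; move: E.
  by rewrite eqxx mul1r => <-; rewrite -mulr2n -mulr_natl z mulr0.
(* A nonzero constant term on a surface is exactly t / 2, so any other nonzero point value or
   constant term would also be t / 2. *)
have [j xj|sv0] := pickP (fun j => sv x j != 0).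
  constructor 2; exists j; case: (surface_relations xj) => rp rs rt.
  have := rt j; rewrite eqxx mul1r => ej.
  have tE : t = 2 * sv x j.
    have := rs j; move/eqP; rewrite mulf_eq0 (negbTE xj) /= subr_eq0 => /eqP <-.
    by ring.
  split=> // [i|q qj].
    apply/eqP/negPn/negP => xi.
    have := rp i; move/eqP; rewrite mulf_eq0 (negbTE xi) /= => /eqP E.
    have xiE : pt x i = sv x j.
      by apply: (addIr (sv x j - t)); rewrite addrA E tE; ring.
    by have := diag i xi; rewrite xiE tE subrr eqxx.
  have uq : sv x q = 0.
    apply/eqP/negPn/negP => xq.
    case: (surface_relations xq) => _ _ /(_ q); rewrite eqxx mul1r => eq_.
    have qE : sv x q = sv x j.
      have := rs q; move/eqP; rewrite mulf_eq0 (negbTE xq) /= => /eqP E.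
      by apply: (addIr (sv x j - t)); rewrite addrA E tE; ring.
    have := c0 q; rewrite -eq_ -[X in X != 0](_ : (q == j)%:R * c j = _).
      by rewrite (negbTE qj) mul0r eqxx.
    by rewrite -rt qE.
  split=> //; have := rt q; rewrite uq (negbTE qj) mul0r tE => /eqP.
  rewrite mulf_eq0 => /orP[/eqP//|/eqP E]; case/negP: xj.
  by rewrite -oppr_eq0 -E; apply/eqP; ring.
have {}sv0 j : sv x j = 0 by have := sv0 j => /negbT /negPn/eqP.
have [i xi|pt0] := pickP (fun i => pt x i != 0); last first.
  have := brxx; rewrite bracketE !big1 ?subr0 ?addr0 => [/esym/eqP|j _|j _|i _].
  - by rewrite oner_eq0.
  - by rewrite stM sv0 mulr0 mul0r addr0 mul0r.
  - by rewrite svM sv0 !mulr0 mul0r.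
  - by have /negbT/negPn/eqP pi := pt0 i; rewrite ptM pi mulr0 mul0r.
case: (point_relations xi) => rp rs rt.
(* Two nonzero point values add up to t; a third would make them equal, against [diag]. *)
have [i' /andP[i'i xi']|one] := pickP (fun q => (q != i) && (pt x q != 0)).
  constructor 1; exists i, i'.
  have ti : t = pt x i' + pt x i.
    have := rp i'; rewrite (negbTE i'i) mul0r => /eqP.
    by rewrite mulf_eq0 (negbTE xi') /= subr_eq0 => /eqP.
  split=> //; first by rewrite eq_sym.
  - move=> q qi qi'; apply/eqP/negPn/negP => xq.
    case: (point_relations xi') => /(_ q); rewrite (negbTE qi') mul0r => /eqP.
    rewrite mulf_eq0 (negbTE xq) /= => /eqP E' _ _.
    have := rp q; rewrite (negbTE qi) mul0r => /eqP.
    rewrite mulf_eq0 (negbTE xq) /= => /eqP E.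
    have ii : pt x i = pt x i'.
      by apply: (addIr (- t)); apply: (addrI (pt x q)); rewrite !addrA E E'.
    have := diag i xi; rewrite ti -ii.
    by rewrite mulr_natl mulr2n subrr eqxx.
  - move=> j; split=> //; have := rt j; rewrite sv0 => /eqP.
    rewrite mulf_eq0 => /orP[/eqP//|/eqP E]; case/negP: xi'.
    by rewrite -oppr_eq0 -E ti; apply/eqP; ring.
constructor 3; exists i.
have {}one q : q != i -> pt x q = 0.
  by move=> qi; have := one q; rewrite qi => /negbT/negPn/eqP.
have [j vj|st0] := pickP (fun j => st x j != 0).
  exists j; split=> // q qj.
  case: (tau_relations (sv0 j) vj) => rp' rt'.
  have := rt' q; rewrite (negbTE qj) mul0r => /eqP.
  rewrite mulf_eq0 => /orP[/eqP//|].
  rewrite sv0 mulr0 sub0r oppr_eq0 => /eqP t0.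
  have := rt' j; rewrite eqxx mul1r sv0 t0 mulr0 subr0 mulr0 => /esym/eqP.
  by rewrite (negbTE (c0 j)).
have := brx; rewrite bracketE (sum_single (i := i)) => [|q /one ->]; last first.
  by rewrite mul0r.
rewrite !big1 ?subr0 ?addr0 => [/eqP|j _|j _].
- by rewrite mulf_eq0 invr_eq0 (negbTE xi) (negbTE (e0 i)).
- by have /negbT/negPn/eqP -> := st0 j; rewrite mul0r.
- by rewrite sv0 mulr0 mul0r.
Qed.

Variable rho : H.
Hypothesis F2 : 2%:R != 0 :> F.
Hypotheses (tE : t = br (x ^+ 3)) (rho1 : br (rho * x) = t)
  (rho2 : br (rho * x ^+ 2) = 5 * br (x ^+ 4) - 3 * t ^+ 2).

Let x3 : x ^+ 3 = x * x * x. Proof. by ring. Qed.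
Let x4 : x ^+ 4 = x * x * x * x. Proof. by ring. Qed.

(** With X, Y for the two values, <x> = 0 and <x^2> = 1 give X / e_i = - Y / e_i' = 1 / (X - Y). The
    two conditions on [rho] are then linear equations for its two values; the results are the
    invariants of the pairs (X, X - Y) and (Y, Y - X). *)
Lemma two_point_values i i' : i != i' -> pt x i != 0 -> pt x i' != 0 ->
  (forall q, q != i -> q != i' -> pt x q = 0) ->
  (forall j, sv x j = 0 /\ st x j = 0) ->
  [/\ pt x i != pt x i',
      e i = pt x i * (pt x i - pt x i'), e i' = pt x i' * (pt x i' - pt x i),
      pt rho i = pt x i ^+ 2 + (pt x i - pt x i') ^+ 2 &
      pt rho i' = pt x i' ^+ 2 + (pt x i' - pt x i) ^+ 2].
Proof.
move=> ii' X0 Y0 off s0; move: (e0 i) (e0 i').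
have brE y : br (y * x) = pt y i * (pt x i / e i) + pt y i' * (pt x i' / e i').
  rewrite bracketE [X in _ + X]big1 => [|j _]; last first.
    by rewrite stM (s0 j).1 (s0 j).2 !mulr0 addr0 mul0r.
  rewrite [X in _ - X]big1 => [|j _]; last first.
    by rewrite svM (s0 j).1 !mulr0 mul0r.
  rewrite subr0 addr0 (bigD1 i) // (bigD1 i') 1?eq_sym //= big1 => [|q].
    by rewrite addr0 !ptM !mulrA.
  by case/andP=> qi qi'; rewrite ptM off // mulr0 mul0r.
have := brxx; rewrite brE; have := brx; rewrite -{1}[x]mul1r brE.
rewrite -sc1 !pt_sc; move: tE rho1 rho2.
rewrite x3 x4 expr2 mulrA !brE !ptM.
move: (pt x i) (pt x i') X0 Y0 (pt rho i) (pt rho i') (e i) (e i').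
move=> X Y X0 Y0 r r' e1 e2; set A := X / e1; set B := Y / e2.
rewrite !mul1r => -> R1 R2 A1 A2 e10 e20.
have BE : B = - A by apply: (addrI A); rewrite A1 subrr.
move: A2 R1 R2; rewrite BE => A2 R1 R2.
have A2' : A * (X - Y) = 1 by rewrite -A2; ring.
have XY : X - Y != 0.
  apply: contraTneq isT => z; move: A2'; rewrite z mulr0 => /esym/eqP.
  by rewrite oner_eq0.
have AE : A = (X - Y)^-1 by apply: (mulIf XY); rewrite A2' mulVf.
have e1E : e1 = X * (X - Y).
  apply: (mulIf (_ : A != 0)); rewrite ?AE ?invr_eq0 // mulfK //.
  by rewrite -AE /A mulrC divfK.
have e2E : e2 = Y * (Y - X).
  apply: (mulIf (_ : B != 0)); first by rewrite BE oppr_eq0 AE invr_eq0.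
  rewrite {1}/B mulrC divfK // BE AE; by field.
have rE : r = r' + (X - Y) * (X + Y).
  apply: (mulIf (_ : A != 0)); first by rewrite AE invr_eq0.
  transitivity (r * A + r' * - A + r' * A); first by ring.
  by rewrite R1 AE; field.
have r'E : r' = Y ^+ 2 + (Y - X) ^+ 2.
  move: R2; rewrite rE AE => R2.
  transitivity ((r' + (X - Y) * (X + Y)) * X * (X - Y)^-1
     + r' * Y * - (X - Y)^-1 - (X + Y) * X); first by field.
  by rewrite R2; field.
by split=> //; [rewrite -subr_eq0 | rewrite rE r'E; ring].
Qed.

(** Write x = u + v tau at j. Then <x> = 0 gives v c = d u, next <x^2> = 1 gives d u^2 = c^2, and
    finally <rho x> = 2 d u and <x^3> = 2 u give d = 1. *)
Lemma one_surface_values j : sv x j != 0 -> (forall i, pt x i = 0) ->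
  (forall q, q != j -> sv x q = 0 /\ st x q = 0) ->
  sv rho j = c j ^+ 2 -> st rho j = 2 * c j * d j ->
  [/\ d j = 1, sv x j = st x j * c j & st x j ^+ 2 = 1].
Proof.
move=> u0 p0 off; move: (c0 j).
have brE y : br (y * x) = (sv y j * st x j + st y j * sv x j) / c j
    - d j * (sv y j * sv x j) / c j ^+ 2.
  rewrite bracketE [X in _ + X](sum_single (i := j)) => [|q qj]; last first.
    by rewrite stM !(off q qj).1 !(off q qj).2 !mulr0 addr0 mul0r.
  rewrite [X in _ - X](sum_single (i := j)) => [|q qj]; last first.
    by rewrite svM (off q qj).1 !mulr0 mul0r.
  rewrite big1 => [|i _]; last by rewrite ptM p0 mulr0 mul0r.
  by rewrite svM stM add0r addrC.
have := brxx; rewrite brE; have := brx; rewrite -{1}[x]mul1r brE.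
rewrite -sc1 !sv_sc !st_sc; move: tE rho1.
rewrite x3 !brE !svM !stM.
move: (sv x j) (st x j) u0 (sv rho j) (st rho j) (d j) (c j).
move=> u v u0 r1 r2 D C -> R1 B1 B2 C0 r1E r2E.
move: R1; rewrite r1E r2E => {r1E r2E} R1.
have vC : v * C = D * u.
  apply/eqP; rewrite -subr_eq0.
  rewrite -(mulrI_eq0 _ (mulfI (invr_neq0 (expf_neq0 2 C0)))).
  by rewrite -B1; apply/eqP; field.
have vE : v = D * u / C by rewrite -vC mulfK.
have CE : D * u ^+ 2 = C ^+ 2.
  transitivity (((u * v + v * u) / C - D * (u * u) / C ^+ 2) * C ^+ 2).
    by rewrite vE; field.
  by rewrite B2 mul1r.
have D1 : D = 1.
  apply: (mulfI F2); apply: (mulIf u0); rewrite mulr1.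
  transitivity ((C ^+ 2 * v + 2 * C * D * u) / C - D * (C ^+ 2 * u) / C ^+ 2).
    by rewrite vE; field.
  rewrite R1; apply: (mulIf (expf_neq0 2 C0)).
  transitivity (2 * (D * u ^+ 2) * u); first by rewrite vE; field.
  by rewrite CE; ring.
move: vC CE; rewrite D1 !mul1r => vC CE; split=> //.
by apply: (mulIf (expf_neq0 2 C0)); rewrite -exprMn vC CE mul1r.
Qed.

(** As tau^2 = 0, all powers of [x] from the square on live at the point. So <x^2> = 1 gives [e i],
    the condition on <rho x^2> gives [pt rho i], and the other two conditions relate the point to
    the surface. *)
Lemma point_tau_values i j : pt x i != 0 -> st x j != 0 ->
  (forall q, q != i -> pt x q = 0) -> (forall q, sv x q = 0) ->
  (forall q, q != j -> st x q = 0) -> sv rho j = c j ^+ 2 ->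
  [/\ e i = pt x i ^+ 2, pt rho i = 2 * pt x i ^+ 2,
      pt x i = - (st x j * c j) & st x j ^+ 2 = 1].
Proof.
move=> X0 v0 offp s0 offs; move: (c0 j) (e0 i).
have brE y : br (y * x) = pt y i * pt x i / e i + sv y j * st x j / c j.
  rewrite bracketE (sum_single (i := i)) => [|q qi]; last first.
    by rewrite ptM offp // mulr0 mul0r.
  rewrite [X in _ + X](sum_single (i := j)) => [|q qj]; last first.
    by rewrite stM s0 offs // !mulr0 addr0 mul0r.
  rewrite big1 => [|q _]; last by rewrite svM s0 !mulr0 mul0r.
  by rewrite ptM stM s0 mulr0 addr0 subr0.
have := brxx; rewrite brE; have := brx; rewrite -{1}[x]mul1r brE.
rewrite -sc1 !pt_sc !sv_sc; move: tE rho1 rho2.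
rewrite x3 x4 expr2 mulrA !brE !ptM !svM !s0.
move: (pt x i) (st x j) X0 v0 (pt rho i) (sv rho j) (e i) (c j).
move=> X v X0 v0 r s E C -> R1 R2 B1 B2 C0 E0 sE.
have EE : E = X ^+ 2.
  apply: (mulIf (invr_neq0 E0)); rewrite mulfV // -B2; by field; rewrite C0 E0.
move: B1 R1 R2; rewrite EE sE => B1 R1 R2.
have vE : v = - C / X.
  transitivity ((1 * X / X ^+ 2 + 1 * v / C) * C - C / X).
    by field; rewrite ?X0 ?C0.
  by rewrite B1; field.
have rE : r = 2 * X ^+ 2.
  transitivity (r * X * X / X ^+ 2 + s * 0 * v / C).
    by field; rewrite ?X0 ?C0.
  by rewrite sE R2; field; rewrite ?X0 ?C0.
have CX : C ^+ 2 = X ^+ 2.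
  transitivity (- (r * X / X ^+ 2 + C ^+ 2 * v / C) * X + r).
    by rewrite vE; field; rewrite ?X0 ?C0.
  by rewrite R1 rE; field; rewrite ?X0 ?C0.
have XE : X = - (v * C).
  by apply: (mulIf X0); rewrite -expr2 -CX vE; field; rewrite ?X0 ?C0.
by split=> //; rewrite vE expr_div_n sqrrN CX divff // expf_neq0.
Qed.

End Support.

(** * Reindexing and connected sums *)

Section Components.

Variables (p : nat) (I J K : finType) (W : weight_data p I J K).

Lemma bracketE (y : wring p I J) :
  bracket W y = \sum_i pt y i / (wa W i * wb W i)
  - \sum_j wdelta W j * sv y j / wc W j ^+ 2 + \sum_j st y j / wc W j.
Proof. by []. Qed.

Lemma pt_rho i : pt (rho W) i = wa W i ^+ 2 + wb W i ^+ 2.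
Proof. by rewrite /pt ffunE. Qed.
Lemma sv_rho j : sv (rho W) j = wc W j ^+ 2.
Proof. by rewrite /sv ffunE !dualE mulr1 mulr0 addr0. Qed.
Lemma st_rho j : st (rho W) j = 2 * wc W j * wdelta W j.
Proof. by rewrite /st ffunE !dualE mulr1 mulr0 add0r. Qed.

Lemma pt_euler i : pt (euler W) i = wa W i * wb W i.
Proof. by rewrite /pt ffunE. Qed.
Lemma sv_euler j : sv (euler W) j = 0.
Proof. by rewrite /sv ffunE !dualE mulr0. Qed.
Lemma st_euler j : st (euler W) j = 2 * wc W j.
Proof. by rewrite /st ffunE !dualE mulr1. Qed.

Lemma pt_signed_weight e i :
  pt (signed_weight W e) i = \sum_k (-1) ^+ e k * pt (weight W k) i.
Proof.
rewrite /signed_weight.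
rewrite (big_morph (fun x => pt x i) (fun x y => ptD x y i) (pt0 _ _ i)).
by apply: eq_bigr => k _; rewrite ptZ.
Qed.
Lemma sv_signed_weight e j :
  sv (signed_weight W e) j = \sum_k (-1) ^+ e k * sv (weight W k) j.
Proof.
rewrite /signed_weight.
rewrite (big_morph (fun x => sv x j) (fun x y => svD x y j) (sv0 _ _ j)).
by apply: eq_bigr => k _; rewrite svZ.
Qed.
Lemma st_signed_weight e j :
  st (signed_weight W e) j = \sum_k (-1) ^+ e k * st (weight W k) j.
Proof.
rewrite /signed_weight.
rewrite (big_morph (fun x => st x j) (fun x y => stD x y j) (st0 _ _ j)).
by apply: eq_bigr => k _; rewrite stZ.
Qed.

End Components.

Lemma pair_equiv_invariants p (a b c d : 'F_p) : pair_equiv (a, b) (c, d) ->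
  a * b = c * d /\ a ^+ 2 + b ^+ 2 = c ^+ 2 + d ^+ 2.
Proof. by case=> -[-> ->] /=; split=> //; ring. Qed.

(** Pullback along [f] and [g] is a ring morphism that respects the bracket, [rho], [euler] and the
    weights; equivalent pairs have the same invariants, so nothing else about them matters. *)
Lemma weight_system_reindex (p : nat) (I J K I' J' K' : finType)
    (W : weight_data p I J K) (W' : weight_data p I' J' K') :
  same_up_to_reindexing W W' -> weight_system W -> weight_system W'.
Proof.
move=> [f [g [h [[fb gb hb] [abE cE dE pE sE]]]]].
have [h' hK h'K] := hb.
move=> /weight_systemE[c1 c2 nz [b1 bw orth [brho W6 W7 W8]]].
have abM i : wa W i * wb W i = wa W' (f i) * wb W' (f i).
  by case: (pair_equiv_invariants (abE i)).
have abS i : wa W i ^+ 2 + wb W i ^+ 2 = wa W' (f i) ^+ 2 + wb W' (f i) ^+ 2.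
  by case: (pair_equiv_invariants (abE i)).
have [F FE] : exists F : wring p I' J' -> wring p I J, forall y,
    F y = mkw (fun i => pt y (f i)) (fun j => sv y (g j)) (fun j => st y (g j)).
  by eexists.
have ptF y i : pt (F y) i = pt y (f i) by rewrite FE pt_mkw.
have svF y j : sv (F y) j = sv y (g j) by rewrite FE sv_mkw.
have stF y j : st (F y) j = st y (g j) by rewrite FE st_mkw.
have FM : {morph F : x y / x * y}.
  move=> x y; apply: wringP => i; rewrite ?ptF ?svF ?stF.
  - by rewrite !ptM !ptF.
  - by rewrite !svM !svF.
  - by rewrite !stM !svF !stF.
have FD : {morph F : x y / x + y}.
  move=> x y; apply: wringP => i; rewrite ?ptF ?svF ?stF.
  - by rewrite !ptD !ptF.
  - by rewrite !svD !svF.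
  - by rewrite !stD !stF.
have F1 : F 1 = 1.
  apply: wringP => i; rewrite ?ptF ?svF ?stF.
  - by rewrite !pt1.
  - by rewrite !sv1.
  - by rewrite !st1.
have Frho : F (rho W') = rho W.
  apply: wringP => i; rewrite ?ptF ?svF ?stF.
  - by rewrite !pt_rho abS.
  - by rewrite !sv_rho cE.
  - by rewrite !st_rho cE dE.
have Fe : F (euler W') = euler W.
  apply: wringP => i; rewrite ?ptF ?svF ?stF.
  - by rewrite !pt_euler abM.
  - by rewrite !sv_euler.
  - by rewrite !st_euler cE.
have Fw k : F (weight W' (h k)) = weight W k.
  apply: wringP => i; rewrite ?ptF ?svF ?stF.
  - by rewrite /pt pE.
  - by rewrite /sv sE.
  - by rewrite /st sE.
have Fw' k : F (weight W' k) = weight W (h' k) by rewrite -Fw h'K.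
have Fs e : F (signed_weight W' e) = signed_weight W (fun k => e (h k)).
  have hbij (R : nmodType) (G : K' -> R) : \sum_k G k = \sum_k G (h k).
    by rewrite (reindex h) //; apply: onW_bij.
  apply: wringP => i; rewrite ?ptF ?svF ?stF.
  - rewrite !pt_signed_weight hbij; apply: eq_bigr => k _.
    by rewrite -Fw ptF.
  - rewrite !sv_signed_weight hbij; apply: eq_bigr => k _.
    by rewrite -Fw svF.
  - rewrite !st_signed_weight hbij; apply: eq_bigr => k _.
    by rewrite -Fw stF.
have brE y : bracket W' y = bracket W (F y).
  rewrite !bracketE (reindex f) /=; last exact: onW_bij.
  rewrite (reindex g) /=; last exact: onW_bij.
  rewrite [X in _ + X](reindex g) /=; last exact: onW_bij.
  congr (_ - _ + _); apply: eq_bigr => i _.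
  - by rewrite ptF abM.
  - by rewrite svF cE dE.
  - by rewrite stF cE.
have cardsI := bij_eq_card fb; have cardsJ := bij_eq_card gb.
have cardsK := bij_eq_card hb.
have F2 (R : comPzRingType) (x : R) : x ^+ 2 = x * x by ring.
have F2w z k : F (z + 2 * weight W' k) = F z + 2 * weight W (h' k).
  rewrite FD !mulr_natl; congr (_ + _).
  by rewrite !mulr2n FD Fw'.
have CE : 7 * bracket W' (rho W' ^+ 2) - 4 * bracket W' (euler W' ^+ 2)
    = 7 * bracket W (rho W ^+ 2) - 4 * bracket W (euler W ^+ 2).
  by rewrite !brE !F2 !FM Frho Fe.
apply/weight_systemE; rewrite CE.
split; [by rewrite -cardsI -cardsJ | | | split].
- by rewrite -cardsI -cardsJ -cardsK.
- split=> [i | j].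
    have [f' _ f'K] := fb; case: (nz) => /(_ (f' i)) [a0 b0] _.
    have := mulf_neq0 a0 b0; rewrite abM f'K mulf_eq0 negb_or => /andP[] //.
  have [g' _ g'K] := gb; case: (nz) => _ /(_ (g' j)).
  by rewrite cE g'K.
- by rewrite brE F1.
- by move=> k; rewrite brE Fw'.
- move=> k l; rewrite brE FM !Fw' orth (inj_eq (can_inj h'K)) //.
split.
- by rewrite brE Frho brho cardsK.
- by move=> e; rewrite (cubic_morph FM Frho brE) Fs.
- by move=> e; rewrite (quartic_morph FM Frho brE) Fs.
- move=> k e; rewrite (quartic_morph FM Frho brE) (cubic_morph FM Frho brE).
  by rewrite F2w Fs.
Qed.

(* H of a connected sum is the image of a subring of H_1 x H_2, given by
   [agree], under a ring morphism [glue] that adds up the brackets. *)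
Section GluedSystem.

Variables (p : nat) (I1 J1 K1 I2 J2 K2 I J : finType).
Variables (W1 : weight_data p I1 J1 K1) (W2 : weight_data p I2 J2 K2).
Variable V : weight_data p I J (K1 + K2)%type.
Variables (agree : wring p I1 J1 -> wring p I2 J2 -> Prop)
  (glue : wring p I1 J1 -> wring p I2 J2 -> wring p I J).

Hypothesis agreeM : forall x1 x2 y1 y2,
  agree x1 x2 -> agree y1 y2 -> agree (x1 * y1) (x2 * y2).
Hypothesis agreeD : forall x1 x2 y1 y2,
  agree x1 x2 -> agree y1 y2 -> agree (x1 + y1) (x2 + y2).
Hypothesis glueM : forall x1 x2 y1 y2, agree x1 x2 -> agree y1 y2 ->
  glue (x1 * y1) (x2 * y2) = glue x1 x2 * glue y1 y2.
Hypothesis glueD : forall x1 x2 y1 y2,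
  glue (x1 + y1) (x2 + y2) = glue x1 x2 + glue y1 y2.
Hypothesis bracket_glue : forall x1 x2, agree x1 x2 ->
  bracket V (glue x1 x2) = bracket W1 x1 + bracket W2 x2.
Hypotheses (agree1 : agree 1 1) (glue1 : glue 1 1 = 1).
Hypotheses (agree_rho : agree (rho W1) (rho W2))
  (glue_rho : glue (rho W1) (rho W2) = rho V).
Hypotheses (agree_euler : agree (euler W1 ^+ 2) (euler W2 ^+ 2))
  (glue_euler : glue (euler W1 ^+ 2) (euler W2 ^+ 2) = euler V ^+ 2).
Hypothesis agree_weight : forall k, agree 0 (weight W2 k).
Hypothesis glue_weight : forall k, glue 0 (weight W2 k) = weight V (inr k).
Hypothesis agree_signed : forall e1 e2,
  agree (signed_weight W1 e1) (signed_weight W2 e2).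
Hypothesis glue_signed : forall e,
  glue (signed_weight W1 (fun k => e (inl k)))
    (signed_weight W2 (fun k => e (inr k))) = signed_weight V e.

(** The conditions for [V] are the sums of those for [W1] and [W2], so those of [W1] can be
    subtracted. *)
Lemma glued_right : (3 <= #|I2| + 2 * #|J2|)%N ->
  #|K2| = (#|I2| + 2 * #|J2| - 2)%N ->
  (forall i, wa W2 i != 0 /\ wb W2 i != 0) /\ (forall j, wc W2 j != 0) ->
  weight_system W1 -> weight_system V -> weight_system W2.
Proof.
move=> c1 c2 nz.
move=> /weight_systemE[_ _ _ [b1 _ _ [brho W6 W7 _]]].
move=> /weight_systemE[_ _ _ [v1 vw vorth [vrho V6 V7 V8]]].
(* [false] is the sign +1, given to every weight of [W1]; on that side (W6) and (W7) make both forms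
   vanish. *)
pose e e2 (k : K1 + K2) := if k is inr k' then e2 k' else false.
have zE e2 : glue (signed_weight W1 (fun=> false)) (signed_weight W2 e2)
    = signed_weight V (e e2) by rewrite -glue_signed.
have b10 : bracket W1 0 = 0 by exact: bracket0.
have bR x2 : agree 0 x2 -> bracket W2 x2 = bracket V (glue 0 x2).
  by move=> /bracket_glue ->; rewrite b10 add0r.
set C1 := 7 * bracket W1 (rho W1 ^+ 2) - 4 * bracket W1 (euler W1 ^+ 2) in W7.
set C2 := 7 * bracket W2 (rho W2 ^+ 2) - 4 * bracket W2 (euler W2 ^+ 2).
set C := 7 * bracket V (rho V ^+ 2) - 4 * bracket V (euler V ^+ 2) in V7 V8.
have CE : C = C1 + C2.
  have rho2 : bracket V (rho V ^+ 2)
      = bracket W1 (rho W1 ^+ 2) + bracket W2 (rho W2 ^+ 2).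
    by rewrite !expr2 -glue_rho -glueM // bracket_glue //; exact: agreeM.
  have euler2 : bracket V (euler V ^+ 2)
      = bracket W1 (euler W1 ^+ 2) + bracket W2 (euler W2 ^+ 2).
    by rewrite -glue_euler; exact: bracket_glue.
  rewrite /C /C1 /C2 rho2 euler2.
  move: (bracket W1 _) (bracket W1 _) (bracket W2 _) (bracket W2 _) => *; ring.
have cG := cubic_glue agreeM glueM bracket_glue agree_rho glue_rho.
have qG x1 x2 xx := quartic_glue agreeM glueM bracket_glue agree_rho glue_rho
  (x := x1) (y := x2) xx CE.
have z2E e2 k : agree (signed_weight W1 (fun=> false))
      (signed_weight W2 e2 + 2 * weight W2 k) /\
    glue (signed_weight W1 (fun=> false))
      (signed_weight W2 e2 + 2 * weight W2 k)
    = signed_weight V (e e2) + 2 * weight V (inr k).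
  (* The counterpart of [2 * weight W2 k] on the [W1] side is 0, written 0 + 0 to match the doubling
     [x + x]. *)
  have -> : signed_weight W1 (fun=> false)
      = signed_weight W1 (fun=> false) + (0 + 0) by rewrite !addr0.
  have dbl (R : comPzRingType) (x : R) : 2 * x = x + x by ring.
  rewrite !dbl; split; first by apply: agreeD => //; exact: agreeD.
  by rewrite !glueD !glue_weight zE.
apply/weight_systemE; split=> //; split.
- by move: v1; rewrite -glue1 bracket_glue // b1 add0r.
- by move=> k; rewrite bR // glue_weight vw.
- move=> k l; rewrite bR.
    by rewrite -[0](mul0r 0) glueM // !glue_weight vorth.
  by rewrite -[0](mul0r 0); exact: agreeM.
split.
- move: vrho; rewrite -glue_rho bracket_glue // brho card_sum.
  rewrite !natrM natrD mulrDr.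
  by move/addrI.
- move=> e2; have := V6 (e e2); rewrite -zE cG //.
  by rewrite W6 add0r.
- move=> e2; have := V7 (e e2); rewrite -zE qG //.
  by rewrite W7 add0r.
move=> k e2; have [az gz] := z2E e2 k.
by have := V8 (inr k) (e e2); rewrite -gz cG // qG // W6 W7 !add0r.
Qed.

End GluedSystem.

Lemma sum_sig_neq (V : zmodType) (I : finType) (i0 : I) (F : I -> V) :
  \sum_(x : {i : I | i != i0}) F (val x) = \sum_i F i - F i0.
Proof.
rewrite [in RHS](bigD1 i0) //= addrAC subrr add0r.
exact/esym/(big_sub (fun i => i != i0) F).
Qed.

Lemma card_sig_neq (I : finType) (i0 : I) : #|{: {i : I | i != i0}}| = #|I|.-1.
Proof. by rewrite card_sig -(cardC1 i0). Qed.

(** * Connected sums at points *)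

Section PointSum.

Variables (p : nat) (I1 J1 K1 I2 J2 K2 : finType).
Variables (W1 : weight_data p I1 J1 K1) (W2 : weight_data p I2 J2 K2).
Variables (i1 : I1) (i2 : I2).
Local Notation V := (point_sum W1 W2 i1 i2).

(** The coordinates at the two glued points are dropped: for agreeing elements they are equal, and
    the opposite products a b make their contributions to the bracket cancel. *)
Definition point_glue (x : wring p I1 J1) (y : wring p I2 J2) :=
  mkw (fun i : {i : I1 | i != i1} + {i : I2 | i != i2} =>
         match i with inl a => pt x (val a) | inr b => pt y (val b) end)
      (fun j : J1 + J2 => match j with inl a => sv x a | inr b => sv y b end)
      (fun j : J1 + J2 => match j with inl a => st x a | inr b => st y b end).

Definition point_agree (x : wring p I1 J1) (y : wring p I2 J2) :=
  pt x i1 = pt y i2.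

Let ptG x y i : pt (point_glue x y) i =
  match i with inl a => pt x (val a) | inr b => pt y (val b) end.
Proof. exact: pt_mkw. Qed.
Let svG x y j : sv (point_glue x y) j =
  match j with inl a => sv x a | inr b => sv y b end.
Proof. exact: sv_mkw. Qed.
Let stG x y j : st (point_glue x y) j =
  match j with inl a => st x a | inr b => st y b end.
Proof. exact: st_mkw. Qed.

Lemma pt_point_sum k i : pt (weight V k) i = match k, i with
  | inl k1, inl x => pt (weight W1 k1) (val x)
  | inr k2, inr x => pt (weight W2 k2) (val x)
  | _, _ => 0 end.
Proof. by case: k i => k [] i; rewrite /pt ffunE. Qed.
Lemma sv_point_sum k j : sv (weight V k) j = match k, j with
  | inl k1, inl y => sv (weight W1 k1) y
  | inr k2, inr y => sv (weight W2 k2) y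
  | _, _ => 0 end.
Proof. by case: k j => k [] j; rewrite /sv ffunE ?dualE. Qed.
Lemma st_point_sum k j : st (weight V k) j = match k, j with
  | inl k1, inl y => st (weight W1 k1) y
  | inr k2, inr y => st (weight W2 k2) y
  | _, _ => 0 end.
Proof. by case: k j => k [] j; rewrite /st ffunE ?dualE. Qed.

Lemma point_sum_right : point_summable W1 W2 i1 i2 ->
  (3 <= #|I2| + 2 * #|J2|)%N ->
  weight_system W1 -> weight_system V -> weight_system W2.
Proof.
move=> [base1 base2 eM eS] c2 HW1 HV.
have I1_gt0 : (0 < #|I1|)%N by apply/card_gt0P; exists i1.
have I2_gt0 : (0 < #|I2|)%N by apply/card_gt0P; exists i2.
have wt1 k := pt_point_sum (inl k); have wt2 k := pt_point_sum (inr k).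
have ws1 k := sv_point_sum (inl k); have ws2 k := sv_point_sum (inr k).
have wu1 k := st_point_sum (inl k); have wu2 k := st_point_sum (inr k).
have [[nz1 _] [nzV nzJ]] : ((forall i, wa W1 i != 0 /\ wb W1 i != 0) /\
    (forall j, wc W1 j != 0)) /\
    ((forall i, wa V i != 0 /\ wb V i != 0) /\ (forall j, wc V j != 0)).
  by case: HW1 HV => _ _ ? _ [].
apply: (@glued_right _ _ _ _ _ _ _ _ _ W1 W2 V
  point_agree point_glue) => //.
- by move=> x1 x2 y1 y2 hx hy; rewrite /point_agree !ptM hx hy.
- by move=> x1 x2 y1 y2 hx hy; rewrite /point_agree !ptD hx hy.
- move=> x1 x2 y1 y2 _ _; apply: wringP => -[] i;
    by rewrite ?ptM ?svM ?stM !(ptG, svG, stG) ?ptM ?svM ?stM.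
- move=> x1 x2 y1 y2; apply: wringP => -[] i;
    by rewrite ?ptD ?svD ?stD !(ptG, svG, stG) ?ptD ?svD ?stD.
- move=> x y xy; rewrite !bracketE !big_sumType /=.
  under eq_bigr do rewrite ptG.
  under [X in _ + X - _ + _]eq_bigr do rewrite ptG.
  under [X in _ - (X + _) + _]eq_bigr do rewrite svG.
  under [X in _ - (_ + X) + _]eq_bigr do rewrite svG.
  under [X in _ - _ + (X + _)]eq_bigr do rewrite stG.
  under [X in _ - _ + (_ + X)]eq_bigr do rewrite stG.
  rewrite (sum_sig_neq i1 (fun i => pt x i / (wa W1 i * wb W1 i))).
  rewrite (sum_sig_neq i2 (fun i => pt y i / (wa W2 i * wb W2 i))).
  rewrite eM xy invrN mulrN opprK.
  move: (\sum_i _) (\sum_i _) (_ / _).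
  move: (\sum_j _) (\sum_j _) (\sum_j _) (\sum_j _).
  move=> *; ring.
- by rewrite /point_agree !pt1.
- apply: wringP => -[] i;
    by rewrite ?ptG ?svG ?stG ?pt1 ?sv1 ?st1.
- by rewrite /point_agree !pt_rho.
- apply: wringP => -[] i;
    by rewrite ?ptG ?svG ?stG ?pt_rho ?sv_rho ?st_rho.
(* The values of [euler] at the glued points are opposite, so only its square agrees. *)
- by rewrite /point_agree !ptX2 !pt_euler eM mulrNN.
- apply: wringP => -[] i;
    by rewrite ?ptG ?svG ?stG ?ptX2 ?svX2 ?stX2 ?pt_euler ?sv_euler ?st_euler.
- by move=> k; rewrite /point_agree pt0 /pt base2.
- move=> k; apply: wringP => -[] i;
    by rewrite ?ptG ?svG ?stG ?wt2 ?ws2 ?wu2 ?pt0 ?sv0 ?st0.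
- move=> e1 e2; rewrite /point_agree !pt_signed_weight !big1 // => k _.
  + by rewrite /pt base2 mulr0.
  + by rewrite /pt base1 mulr0.
- move=> e; apply: wringP => -[] i;
    rewrite ?(ptG, svG, stG) ?pt_signed_weight ?sv_signed_weight;
    rewrite ?st_signed_weight big_sumType /=.
  + rewrite [X in _ = _ + X]big1 => [|k _]; last by rewrite wt2 mulr0.
    by rewrite addr0; apply: eq_bigr => k _; rewrite wt1.
  + rewrite [X in _ = X + _]big1 => [|k _]; last by rewrite wt1 mulr0.
    by rewrite add0r; apply: eq_bigr => k _; rewrite wt2.
  + rewrite [X in _ = _ + X]big1 => [|k _]; last by rewrite ws2 mulr0.
    by rewrite addr0; apply: eq_bigr => k _; rewrite ws1.
  + rewrite [X in _ = X + _]big1 => [|k _]; last by rewrite ws1 mulr0.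
    by rewrite add0r; apply: eq_bigr => k _; rewrite ws2.
  + rewrite [X in _ = _ + X]big1 => [|k _]; last by rewrite wu2 mulr0.
    by rewrite addr0; apply: eq_bigr => k _; rewrite wu1.
  + rewrite [X in _ = X + _]big1 => [|k _]; last by rewrite wu1 mulr0.
    by rewrite add0r; apply: eq_bigr => k _; rewrite wu2.
- have [e1 e2] : #|K1| = (#|I1| + 2 * #|J1| - 2)%N /\
      (3 <= #|I1| + 2 * #|J1|)%N.
    by case: HW1.
  have : #|{: K1 + K2}| = (#|{: {i : I1 | i != i1} + {i : I2 | i != i2}}|
    + 2 * #|{: J1 + J2}| - 2)%N by case: HV.
  by rewrite !card_sum !card_sig_neq; lia.
- split=> [i | j]; last exact: (nzJ (inr j)).
  (* [i2] is absent from the sum; nonvanishing there comes from the opposite product at [i1]. *)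
  have [->|ni] := eqVneq i i2; last exact: (nzV (inr (Sub i ni))).
  have [a0 b0] := nz1 i1; have := mulf_neq0 a0 b0.
  by rewrite eM oppr_eq0 mulf_eq0 negb_or => /andP[].
Qed.

End PointSum.

(** * Connected sums at surfaces *)

Section SurfaceSum.

Variables (p : nat) (I1 J1 K1 I2 J2 K2 : finType).
Variables (W1 : weight_data p I1 J1 K1) (W2 : weight_data p I2 J2 K2).
Variables (j1 : J1) (j2 : J2).
Local Notation V := (surface_sum W1 W2 j1 j2).

(** Pairs of dual numbers with a common constant term form a ring, and adding their tau-parts is a
    ring morphism to the dual numbers. *)
Definition surface_glue (x : wring p I1 J1) (y : wring p I2 J2) :=
  mkw (fun i : I1 + I2 => match i with inl a => pt x a | inr b => pt y b end)
      (fun j : J1 + {j : J2 | j != j2} =>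
         match j with inl a => sv x a | inr b => sv y (val b) end)
      (fun j : J1 + {j : J2 | j != j2} => match j with
         | inl a => st x a + (if a == j1 then st y j2 else 0)
         | inr b => st y (val b) end).

Definition surface_agree (x : wring p I1 J1) (y : wring p I2 J2) :=
  sv x j1 = sv y j2.

Let ptG x y i : pt (surface_glue x y) i =
  match i with inl a => pt x a | inr b => pt y b end.
Proof. exact: pt_mkw. Qed.
Let svG x y j : sv (surface_glue x y) j =
  match j with inl a => sv x a | inr b => sv y (val b) end.
Proof. exact: sv_mkw. Qed.
Let stG x y j : st (surface_glue x y) j = match j with
  | inl a => st x a + (if a == j1 then st y j2 else 0)
  | inr b => st y (val b) end.
Proof. exact: st_mkw. Qed.

Lemma pt_surface_sum k i : pt (weight V k) i = match k, i with
  | inl k1, inl x => pt (weight W1 k1) x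
  | inr k2, inr x => pt (weight W2 k2) x
  | _, _ => 0 end.
Proof. by case: k i => k [] i; rewrite /pt ffunE. Qed.
Lemma sv_surface_sum k j : sv (weight V k) j = match k, j with
  | inl k1, inl y => sv (weight W1 k1) y
  | inr k2, inl y => if y == j1 then sv (weight W2 k2) j2 else 0
  | inr k2, inr y => sv (weight W2 k2) (val y)
  | _, _ => 0 end.
Proof.
by case: k j => k [] j; rewrite /sv ffunE ?dualE //; case: eqP; rewrite ?dualE.
Qed.
Lemma st_surface_sum k j : st (weight V k) j = match k, j with
  | inl k1, inl y => st (weight W1 k1) y
  | inr k2, inl y => if y == j1 then st (weight W2 k2) j2 else 0
  | inr k2, inr y => st (weight W2 k2) (val y)
  | _, _ => 0 end.
Proof.
by case: k j => k [] j; rewrite /st ffunE ?dualE //; case: eqP; rewrite ?dualE.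
Qed.

Lemma surface_sum_right : surface_summable W1 W2 j1 j2 ->
  (3 <= #|I2| + 2 * #|J2|)%N ->
  weight_system W1 -> weight_system V -> weight_system W2.
Proof.
move=> [base1 base2 cE] c2 HW1 HV.
have J1_gt0 : (0 < #|J1|)%N by apply/card_gt0P; exists j1.
have J2_gt0 : (0 < #|J2|)%N by apply/card_gt0P; exists j2.
have b1 k : sv (weight W1 k) j1 = 0.
  by rewrite /sv; have [x ->] := base1 k; rewrite coef0_dualM coef0_tau mulr0.
have b2 k : sv (weight W2 k) j2 = 0.
  by rewrite /sv; have [x ->] := base2 k; rewrite coef0_dualM coef0_tau mulr0.
have wt1 k := pt_surface_sum (inl k); have wt2 k := pt_surface_sum (inr k).
have ws1 k := sv_surface_sum (inl k).
have ws2 k j : sv (weight V (inr k)) j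
    = if j is inr y then sv (weight W2 k) (val y) else 0.
  by rewrite sv_surface_sum; case: j => // j; rewrite b2 if_same.
have wu1 k := st_surface_sum (inl k); have wu2 k := st_surface_sum (inr k).
have [[_ nz1] [nzI nzV]] : ((forall i, wa W1 i != 0 /\ wb W1 i != 0) /\
    (forall j, wc W1 j != 0)) /\
    ((forall i, wa V i != 0 /\ wb V i != 0) /\ (forall j, wc V j != 0)).
  by case: HW1 HV => _ _ ? _ [].
apply: (@glued_right _ _ _ _ _ _ _ _ _ W1 W2 V
  surface_agree surface_glue) => //.
- by move=> x1 x2 y1 y2 hx hy; rewrite /surface_agree !svM hx hy.
- by move=> x1 x2 y1 y2 hx hy; rewrite /surface_agree !svD hx hy.
- move=> x1 x2 y1 y2 hx hy; apply: wringP => -[] i;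
    rewrite ?ptM ?svM ?stM !(ptG, svG, stG) ?ptM ?svM ?stM //.
  case: eqP => [->|_]; last by rewrite !addr0.
  rewrite -hx -hy.
  move: (sv x1 j1) (sv y1 j1) (st x1 j1) (st x2 j2) (st y1 j1) (st y2 j2).
  move=> *; ring.
- move=> x1 x2 y1 y2; apply: wringP => -[] i;
    rewrite ?ptD ?svD ?stD !(ptG, svG, stG) ?ptD ?svD ?stD //.
  case: eqP => _; last by rewrite !addr0.
  by rewrite addrACA.
- move=> x y xy; rewrite !bracketE !big_sumType /=.
  under eq_bigr do rewrite ptG.
  under [X in _ + X - _ + _]eq_bigr do rewrite ptG.
  under [X in _ - (X + _) + _]eq_bigr do rewrite svG !mulrDl.
  under [X in _ - (_ + X) + _]eq_bigr do rewrite svG.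
  under [X in _ - _ + (X + _)]eq_bigr do rewrite stG mulrDl.
  under [X in _ - _ + (_ + X)]eq_bigr do rewrite stG.
  rewrite (sum_sig_neq j2 (fun j => wdelta W2 j * sv y j / wc W2 j ^+ 2)).
  rewrite (sum_sig_neq j2 (fun j => st y j / wc W2 j)).
  rewrite !big_split /=.
  rewrite [X in _ - (_ + X + _) + _](sum_single (i := j1)) => [|j jj];
    last first.
    by rewrite (negbTE jj) !mul0r.
  rewrite [X in _ + (_ + X + _)](sum_single (i := j1)) => [|j jj]; last first.
    by rewrite (negbTE jj) !mul0r.
  rewrite eqxx xy cE.
  move: (\sum_i _) (\sum_i _) (_ / _) (_ / _).
  move: (\sum_j _) (\sum_j _) (\sum_j _) (\sum_j _).
  move=> *; ring.
- by rewrite /surface_agree !sv1.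
- apply: wringP => -[] i; rewrite ?ptG ?svG ?stG ?pt1 ?sv1 ?st1 //.
  by rewrite if_same addr0.
- by rewrite /surface_agree !sv_rho cE.
- apply: wringP => -[] i; rewrite ?ptG ?svG ?stG ?pt_rho ?sv_rho ?st_rho //=.
  case: eqP => [->|_]; last by rewrite !addr0.
  by rewrite cE mulrDr.
(* Gluing would double the tau-part of [euler] at [j1], but its square is 0 at every surface. *)
- by rewrite /surface_agree !svX2 !sv_euler !mul0r.
- apply: wringP => -[] i;
    rewrite ?ptG ?svG ?stG ?ptX2 ?svX2 ?stX2 ?pt_euler ?sv_euler ?st_euler;
    by rewrite /= ?mulr0 ?mul0r ?addr0 ?if_same ?addr0.
- by move=> k; rewrite /surface_agree sv0 b2.
- move=> k; apply: wringP => -[] i;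
    rewrite ?ptG ?svG ?stG ?wt2 ?ws2 ?wu2 ?pt0 ?sv0 ?st0 //.
  by rewrite add0r.
- move=> e1 e2; rewrite /surface_agree !sv_signed_weight !big1 // => k _.
  + by rewrite b2 mulr0.
  + by rewrite b1 mulr0.
- move=> e; apply: wringP => -[] i;
    rewrite ?(ptG, svG, stG) ?pt_signed_weight ?sv_signed_weight;
    rewrite ?st_signed_weight big_sumType /=.
  + rewrite [X in _ = _ + X]big1 => [|k _]; last by rewrite wt2 mulr0.
    by rewrite addr0; apply: eq_bigr => k _; rewrite wt1.
  + rewrite [X in _ = X + _]big1 => [|k _]; last by rewrite wt1 mulr0.
    by rewrite add0r; apply: eq_bigr => k _; rewrite wt2.
  + rewrite [X in _ = _ + X]big1 => [|k _]; last by rewrite ws2 mulr0.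
    by rewrite addr0; apply: eq_bigr => k _; rewrite ws1.
  + rewrite [X in _ = X + _]big1 => [|k _]; last by rewrite ws1 mulr0.
    by rewrite add0r; apply: eq_bigr => k _; rewrite ws2.
  + congr (_ + _); first by apply: eq_bigr => k _; rewrite wu1.
    under [RHS]eq_bigr do rewrite wu2.
    case: eqP => // _.
    by rewrite big1 // => k _; rewrite mulr0.
  + rewrite [X in _ = X + _]big1 => [|k _]; last by rewrite wu1 mulr0.
    by rewrite add0r; apply: eq_bigr => k _; rewrite wu2.
- have [e1 e2] : #|K1| = (#|I1| + 2 * #|J1| - 2)%N /\
      (3 <= #|I1| + 2 * #|J1|)%N.
    by case: HW1.
  have : #|{: K1 + K2}| = (#|{: I1 + I2}|
    + 2 * #|{: J1 + {j : J2 | j != j2}}| - 2)%N by case: HV.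
  by rewrite !card_sum !card_sig_neq; lia.
- split=> [i | j]; first exact: (nzI (inr i)).
  have [->|nj] := eqVneq j j2; last exact: (nzV (inr (Sub j nj))).
  by rewrite -cE.
Qed.

End SurfaceSum.

(** * Linear actions on CP^2 *)

Lemma single_weight_system (p : nat) (I J : finType)
    (W : weight_data p I J unit) (M3 M4 A B : 'F_p) (x := weight W tt) :
  (#|I| + 2 * #|J| = 3)%N ->
  (forall i, wa W i != 0 /\ wb W i != 0) /\ (forall j, wc W j != 0) ->
  bracket W 1 = 0 -> bracket W x = 0 -> bracket W (x * x) = 1 ->
  bracket W (rho W) = 3 ->
  bracket W (x ^+ 3) = M3 -> bracket W (x ^+ 4) = M4 ->
  bracket W (rho W * x) = M3 ->
  bracket W (x ^+ 2 * rho W) = 5 * M4 - 3 * M3 ^+ 2 ->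
  bracket W (rho W ^+ 2) = A -> bracket W (euler W ^+ 2) = B ->
  15 * M4 - 30 * (5 * M4 - 3 * M3 ^+ 2) + (7 * A - 4 * B) = 0 ->
  weight_system W.
Proof.
move=> c3 nz b1 bx bxx brho EM3 EM4 brx brxx EA EB Q0.
have Q : quartic (bracket W) (rho W)
    (7 * bracket W (rho W ^+ 2) - 4 * bracket W (euler W ^+ 2)) x = 0.
  by rewrite /quartic -[RHS]Q0 -EA -EB -brxx -EM4.
have {}brx : bracket W (rho W * x) = bracket W (x ^+ 3) by rewrite EM3.
rewrite -EM3 -EM4 in brxx.
have cx : cubic (bracket W) (rho W) x = 0 by rewrite /cubic brx subrr.
have bD := bracketD W.
have sE e : signed_weight W e = if e tt then - x else x.
  rewrite /signed_weight (bigD1 tt) //= big1 => [|[]] //.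
  by rewrite addr0; case: (e tt); rewrite ?scaleN1r ?scale1r.
apply/weight_systemE.
split; [by rewrite c3 | by rewrite c3 card_unit | exact: nz | split].
- exact: b1.
- by case; exact: bx.
- by move=> [] []; exact: bxx.
split.
- by rewrite brho card_unit.
- move=> e; rewrite sE; case: (e tt); last exact: cx.
  by rewrite (cubicN bD) cx oppr0.
- move=> e; rewrite sE; case: (e tt); last exact: Q.
  by rewrite quarticN; exact: Q.
(* With sign +1 the argument of (W8) is 3x; with sign -1 it is -x + 2x = x, where both sides
   vanish. *)
move=> [] e; rewrite sE; case: (e tt); last first.
  exact: (single_weight_moment bD cx Q brxx).
have -> : - x + 2 * weight W tt = x by rewrite mulr_natl mulr2n addKr.
by rewrite cx [quartic _ _ _ _]Q expr0n !mulr0.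
Qed.

Lemma ord0_empty : 'I_0 -> False. Proof. by case. Qed.

(* Three isolated fixed points with values X, Y and 0 of the weight; up to sign,
   a and b at a point are the differences with the values at the other two. *)
Definition triangle (p : nat) (X Y : 'F_p) : weight_data p 'I_3 'I_0 unit :=
  WeightData (fun q : 'I_3 => [:: X; Y; X]`_q)
    (fun q : 'I_3 => [:: X - Y; Y - X; Y]`_q) (fun=> 0) (fun=> 0)
    (fun=> mkw (fun q : 'I_3 => [:: X; Y; 0]`_q) (fun=> 0) (fun=> 0)).

(* A fixed point and a fixed line; the weight vanishes at the point. *)
Definition point_line (p : nat) (c v : 'F_p) : weight_data p 'I_1 'I_1 unit :=
  WeightData (fun=> c) (fun=> c) (fun=> c) (fun=> 1)
    (fun=> mkw (fun=> 0) (fun=> v * c) (fun=> v)).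

Section Models.

Variable p : nat.

Lemma ptX3 (I J : finType) (x : wring p I J) i :
  pt (x ^+ 3) i = pt x i ^+ 3.
Proof. by rewrite ptM ptX2. Qed.
Lemma ptX4 (I J : finType) (x : wring p I J) i :
  pt (x ^+ 4) i = pt x i ^+ 4.
Proof. by rewrite ptM ptX3. Qed.

Lemma triangle_sum (F : fieldType) (X Y u0 u1 u2 : F) :
  X != 0 -> Y != 0 -> X - Y != 0 ->
  (u0 / (X * (X - Y)) + u1 / (Y * (Y - X)) + u2 / (X * Y)) * (X * Y * (X - Y))
  = u0 * Y - u1 * X + u2 * (X - Y).
Proof.
move=> X0 Y0 D0; rewrite -(opprB X Y) mulrN invrN mulrN.
by field; rewrite X0 Y0 D0.
Qed.

(** The bracket is the second divided difference at the nodes X, Y, 0, so <x^3> and <x^4> are the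
    complete symmetric polynomials of degrees 1 and 2 in the nodes. *)
Lemma triangle_weight_system (X Y : 'F_p) :
  X != 0 -> Y != 0 -> X != Y -> weight_system (triangle X Y).
Proof.
move=> X0 Y0 XY; have D0 : X - Y != 0 by rewrite subr_eq0.
have D1 : Y - X = - (X - Y) by rewrite opprB.
have D0' : Y - X != 0 by rewrite D1 oppr_eq0.
have XY0 : X * Y * (X - Y) != 0 by rewrite !mulf_neq0.
have brE y : bracket (triangle X Y) y = (pt y ord0 * Y
    - pt y (lift ord0 ord0) * X + pt y (lift ord0 (lift ord0 ord0)) * (X - Y))
    / (X * Y * (X - Y)).
  apply: (canRL (mulfK XY0)).
  rewrite bracketE !big_ord_recl !big_ord0 /= oppr0 !addr0 addrA.
  exact: triangle_sum.
have wE : weight (triangle X Y) tt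
  = mkw (fun q : 'I_3 => [:: X; Y; 0]`_q) (fun=> 0) (fun=> 0) by [].
apply: (single_weight_system (M3 := X + Y) (M4 := X ^+ 2 + X * Y + Y ^+ 2)
  (A := 7 * (X ^+ 2 - X * Y + Y ^+ 2)) (B := X ^+ 2 - X * Y + Y ^+ 2));
  rewrite ?wE; [by rewrite !card_ord | | .. | by ring].
  by split=> [[[|[|[|]]] ?] | []] //=.
all: rewrite brE.
all: rewrite ?(ptM, ptX2, ptX3, ptX4, pt_rho, pt_euler, pt1, pt_mkw) /=.
all: by apply: (canLR (mulfK XY0)); ring.
Qed.

Lemma svX3 (I J : finType) (x : wring p I J) j :
  sv (x ^+ 3) j = sv x j ^+ 3.
Proof. by rewrite svM svX2. Qed.
Lemma svX4 (I J : finType) (x : wring p I J) j :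
  sv (x ^+ 4) j = sv x j ^+ 4.
Proof. by rewrite svM svX3. Qed.
Lemma stX3 (I J : finType) (x : wring p I J) j :
  st (x ^+ 3) j = 3 * sv x j ^+ 2 * st x j.
Proof.
rewrite stM svX2 stX2; move: (sv x j) (st x j) => u v; ring.
Qed.
Lemma stX4 (I J : finType) (x : wring p I J) j :
  st (x ^+ 4) j = 4 * sv x j ^+ 3 * st x j.
Proof.
rewrite stM svX3 stX3; move: (sv x j) (st x j) => u v; ring.
Qed.

(** The moments are those of [triangle] for coinciding nodes X = Y = v c: the line is a double
    node. *)
Lemma point_line_weight_system (c v : 'F_p) :
  c != 0 -> v ^+ 2 = 1 -> weight_system (point_line c v).
Proof.
move=> c0 v1.
have brE y : bracket (point_line c v) y = pt y ord0 / (c * c)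
    - sv y ord0 / c ^+ 2 + st y ord0 / c.
  by rewrite bracketE !big_ord1 /= mul1r.
have vE : v = 1 \/ v = -1.
  by move/eqP: v1; rewrite sqrf_eq1 => /orP[] /eqP; [left | right].
have wE : weight (point_line c v) tt
  = mkw (fun=> 0) (fun=> v * c) (fun=> v) by [].
apply: (single_weight_system (M3 := 2 * v * c) (M4 := 3 * c ^+ 2)
  (A := 7 * c ^+ 2) (B := c ^+ 2));
  rewrite ?wE; [by rewrite !card_ord | by [] | ..].
all: rewrite ?brE.
all: rewrite ?(ptM, ptX2, ptX3, ptX4, pt_rho, pt_euler, pt1, pt_mkw).
all: rewrite ?(svM, svX2, svX3, svX4, sv_rho, sv_euler, sv1, sv_mkw).
all: rewrite ?(stM, svX2, svX3, stX2, stX3, stX4, st_rho, st_euler, st1).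
all: rewrite ?(sv_rho, sv_mkw, st_mkw, sv_euler) /=.
all: by case: vE => E; rewrite ?E; field; rewrite ?c0.
Qed.

End Models.

(** * Splitting off a summand *)

(** Maps out of the index sets of a connected sum can be defined by cases, so the bijections are
    taken in this direction. *)
Lemma same_up_to_reindexing_inv (p : nat) (I J K I' J' K' : finType)
    (W : weight_data p I J K) (W' : weight_data p I' J' K')
    (f : I' -> I) (g : J' -> J) (h : K' -> K) :
  bijective f -> bijective g -> bijective h ->
  (forall i, pair_equiv (wa W (f i), wb W (f i)) (wa W' i, wb W' i)) ->
  (forall j, wc W (g j) = wc W' j) ->
  (forall j, wdelta W (g j) = wdelta W' j) ->
  (forall k i, pt (weight W (h k)) (f i) = pt (weight W' k) i) ->
  (forall k j, sv (weight W (h k)) (g j) = sv (weight W' k) j /\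
               st (weight W (h k)) (g j) = st (weight W' k) j) ->
  same_up_to_reindexing W W'.
Proof.
move=> [f' fK f'K] [g' gK g'K] [h' hK h'K] abE cE dE pE sE.
exists f', g', h'; split; first by split; [exists f | exists g | exists h].
split=> [i|j|j|k i|k j].
- by have := abE (f' i); rewrite f'K.
- by have := cE (g' j); rewrite g'K.
- by have := dE (g' j); rewrite g'K.
- by have := pE (h' k) (f' i); rewrite h'K f'K.
by have [E0 E1] := sE (h' k) (g' j); apply: dualP; [move: E0 | move: E1];
  rewrite /sv /st h'K g'K.
Qed.

Section Splitting.

Variables (p n m : nat) (K : finType) (V : weight_data p 'I_n 'I_m K).
Hypotheses (pp : prime p) (p7 : (7 <= p)%N) (HV : weight_system V).
Hypothesis nm4 : (4 <= n + 2 * m)%N.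
Variable k : K.
Hypothesis kill : forall l, l != k -> weight V k * weight V l = 0.
Local Notation x := (weight V k).

Let K2 : finType := {l : K | l != k}.
Let add_k (l : unit + K2) : K := match l with inl _ => k | inr l => val l end.

Let add_k_bij : bijective add_k.
Proof.
apply: inj_card_bij => [[[]|l] [[]|l'] //= E|].
- by case/eqP: (valP l').
- by case/eqP: (valP l).
- by congr inr; apply: val_inj.
rewrite card_sum card_unit card_sig_neq.
by have : (0 < #|K|)%N; [apply/card_gt0P; exists k | lia].
Qed.

Let pt_kill l i : l != k -> pt x i != 0 -> pt (weight V l) i = 0.
Proof.
move=> /kill /(congr1 (fun y => pt y i)); rewrite ptM pt0 => /eqP.
by rewrite mulf_eq0 => /orP[/eqP->|/eqP//]; rewrite eqxx.
Qed.

Let surface_kill l j : l != k -> sv x j != 0 ->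
  sv (weight V l) j = 0 /\ st (weight V l) j = 0.
Proof.
move=> lk u0; have E := kill lk.
have v0 : sv (weight V l) j = 0.
  move: E => /(congr1 (fun y => sv y j)); rewrite svM sv0 => /eqP.
  by rewrite mulf_eq0 (negbTE u0) => /eqP.
split=> //; move: E => /(congr1 (fun y => st y j)).
rewrite stM st0 v0 mulr0 addr0 => /eqP.
by rewrite mulf_eq0 (negbTE u0) => /eqP.
Qed.

Let tau_kill l j : l != k -> sv x j = 0 -> st x j != 0 ->
  sv (weight V l) j = 0.
Proof.
move=> /kill /(congr1 (fun y => st y j)); rewrite stM st0 => + u0 v0.
by rewrite u0 mul0r add0r => /eqP; rewrite mulf_eq0 (negbTE v0) => /eqP.
Qed.

Let K1 : (1 < #|K|)%N.
Proof. by have := card_weights HV; rewrite !card_ord; lia. Qed.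

Let nzV : (forall i, wa V i != 0 /\ wb V i != 0) /\ (forall j, wc V j != 0).
Proof. by case: HV. Qed.

Let e0 i : wa V i * wb V i != 0.
Proof. by case: nzV => /(_ i) [a0 b0] _; rewrite mulf_neq0. Qed.
Let a0 i : wa V i != 0. Proof. by case: nzV => /(_ i) []. Qed.
Let c0 j : wc V j != 0. Proof. by case: nzV. Qed.

Let brx : bracket V x = 0. Proof. exact: bracket_weight. Qed.
Let brxx : bracket V (x * x) = 1.
Proof. by rewrite bracket_weight2 // eqxx. Qed.
Let rho1 : bracket V (rho V * x) = bracket V (x ^+ 3).
Proof. by case: (isolated_rho pp p7 HV kill). Qed.
Let rho2 : bracket V (rho V * x ^+ 2)
  = 5 * bracket V (x ^+ 4) - 3 * bracket V (x ^+ 3) ^+ 2.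
Proof. by case: (isolated_rho pp p7 HV kill). Qed.
Let brE := bracketE V.

Lemma weight_support :
  [\/ exists i i', [/\ i != i', pt x i != 0, pt x i' != 0,
        forall q, q != i -> q != i' -> pt x q = 0 &
        forall j, sv x j = 0 /\ st x j = 0],
      exists j, [/\ sv x j != 0, forall i, pt x i = 0 &
        forall q, q != j -> sv x q = 0 /\ st x q = 0] |
      exists i j, [/\ pt x i != 0, st x j != 0, forall q, q != i -> pt x q = 0,
        forall q, sv x q = 0 & forall q, q != j -> st x q = 0]].
Proof.
exact: (isolated_support (F := 'F_p) (H := wring p 'I_n 'I_m)
  (pt := @pt _ _ _) (sv := @sv _ _ _) (st := @st _ _ _)
  (@ptM _ _ _) (@svM _ _ _) (@stM _ _ _) (@ptD _ _ _)
  (@svD _ _ _) (@stD _ _ _) (@pt_sc _ _ _) (@sv_sc _ _ _) (@st_sc _ _ _)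
  (@pt_mkw _ _ _) (@sv_mkw _ _ _) (@st_mkw _ _ _) brE e0 c0
  (isolated_mul pp p7 HV K1 kill) brx brxx).
Qed.

(* [lift i] skips the point i, and i' is replaced by the point (X, -Y). *)
Lemma split_two_points i i' : i != i' -> pt x i != 0 -> pt x i' != 0 ->
  (forall q, q != i -> q != i' -> pt x q = 0) ->
  (forall j, sv x j = 0 /\ st x j = 0) ->
  is_connected_sum 3 0 n.-1 m V.
Proof.
move=> ii' X0 Y0 off s0.
have [XY eX eY rX rY] := two_point_values (F := 'F_p) (H := wring p 'I_n 'I_m)
  (pt := @pt _ _ _) (sv := @sv _ _ _) (st := @st _ _ _)
  (@ptM _ _ _) (@svM _ _ _)
  (@stM _ _ _) (@pt_sc _ _ _) (@sc1 _ _ _) brE e0 brx brxx erefl rho1 rho2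
  ii' X0 Y0 off s0.
have [i2 i2E _] := unlift_some ii'.
set X := pt x i in X0 XY eX eY rX rY; set Y := pt x i' in Y0 XY eX eY rX rY.
pose W1 := triangle X Y.
pose W2 : weight_data p 'I_n.-1 'I_m K2 := WeightData
  (fun q => if q == i2 then X else wa V (lift i q))
  (fun q => if q == i2 then - Y else wb V (lift i q)) (wc V) (wdelta V)
  (fun l => mkw (fun q => pt (weight V (val l)) (lift i q))
    (sv (weight V (val l))) (st (weight V (val l)))).
have n_gt1 : (1 < n)%N.
  by case: (i) (i') ii' => a ? [b ?]; rewrite -val_eqE /=; lia.
have WS1 : weight_system W1 by exact: triangle_weight_system.
have summable : point_summable W1 W2 ord_max i2.
  split=> [l|l||].
  - by rewrite -/(pt _ _) pt_mkw.
  - by rewrite -/(pt _ _) pt_mkw -i2E pt_kill // (valP l).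
  - by rewrite /= eqxx mulrN opprK.
  - by rewrite /= eqxx sqrrN.
pose f (q : {q : 'I_3 | q != ord_max} + {q : 'I_n.-1 | q != i2}) : 'I_n :=
  match q with
  | inl q => if val (val q) == 0%N then i else i'
  | inr q => lift i (val q) end.
pose g (j : 'I_0 + 'I_m) : 'I_m := match j with
  | inl j => match ord0_empty j with end | inr j => j end.
have neq_i' (q : {q : 'I_n.-1 | q != i2}) : lift i (val q) != i'.
  by rewrite i2E (inj_eq lift_inj) (valP q).
have neq_i (q : 'I_n.-1) : lift i q != i by rewrite eq_sym neq_lift.
have fb : bijective f.
  apply: inj_card_bij => [[q|q] [q'|q'] /=|].
  - case: q q' => -[[|[|[|q]]] hq] hq2 //= [[[|[|[|q']]] hq'] hq2'] //= E;
      try by [congr inl; apply: val_inj; apply: val_inj].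
    + by rewrite E eqxx in ii'.
    + by rewrite E eqxx in ii'.
  - case: ifP => _ E; first by move: (neq_i (val q')); rewrite -E eqxx.
    by move: (neq_i' q'); rewrite -E eqxx.
  - case: ifP => _ E; first by move: (neq_i (val q)); rewrite E eqxx.
    by move: (neq_i' q); rewrite E eqxx.
  - by move/lift_inj => E; congr inr; apply: val_inj.
  by rewrite card_sum !card_sig_neq !card_ord; lia.
have gb : bijective g by exists inr => // -[[]|].
have same : same_up_to_reindexing V (point_sum W1 W2 ord_max i2).
  apply: (same_up_to_reindexing_inv fb gb add_k_bij).
  - move=> [[[[|[|[|q]]] hq] hq2]|q] //=.
    + by apply: pair_equiv_of_invariants; rewrite ?a0 // -pt_rho.
    + by apply: pair_equiv_of_invariants; rewrite ?a0 // -pt_rho.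
    + by rewrite (negbTE (valP q)); constructor.
  - by move=> [[]|].
  - by move=> [[]|].
  - move=> [[]|l] [q|q]; rewrite pt_point_sum ?pt_mkw //=.
    + by case: q => -[[|[|[|q]]] hq] hq2.
    + by rewrite off // neq_i'.
    + by case: ifP => _; rewrite pt_kill // (valP l).
  - move=> l [q|j]; first by case: (ord0_empty q).
    case: l => [[]|l]; rewrite sv_point_sum st_point_sum ?sv_mkw ?st_mkw //=.
exists unit, K2, W1, W2; split=> //; last by left; exists ord_max, i2.
apply: (point_sum_right summable) => //; first by rewrite !card_ord; lia.
exact: weight_system_reindex same HV.
Qed.

(** The other weights vanish on the surface [j], which therefore goes to [W1] entirely. [W2] gains a
    point with pair (c, -c), matching the point (c, c) of [point_line], and all its weights are 0
    there. *)
Lemma split_surface j : sv x j != 0 -> (forall i, pt x i = 0) ->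
  (forall q, q != j -> sv x q = 0 /\ st x q = 0) ->
  is_connected_sum 1 1 n.+1 m.-1 V.
Proof.
move=> u0 p0 off.
have [dE uE v1] := one_surface_values (F := 'F_p) (H := wring p 'I_n 'I_m)
  (pt := @pt _ _ _) (sv := @sv _ _ _) (st := @st _ _ _)
  (@ptM _ _ _) (@svM _ _ _)
  (@stM _ _ _) (@sv_sc _ _ _) (@sc1 _ _ _) (@st_sc _ _ _) brE c0 brx brxx
  (Fp_nat_neq0 pp p7 (k := 2) isT) erefl rho1 u0 p0 off
  (sv_rho V j) (st_rho V j).
have m_gt0 : (0 < m)%N by case: (j) => a; lia.
set c := wc V j in uE.
pose W1 := point_line c (st x j).
pose W2 : weight_data p 'I_n.+1 'I_m.-1 K2 := WeightData
  (fun q => if unlift ord0 q is Some i then wa V i else c)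
  (fun q => if unlift ord0 q is Some i then wb V i else - c)
  (fun q => wc V (lift j q)) (fun q => wdelta V (lift j q))
  (fun l => mkw (fun q => if unlift ord0 q is Some i
                          then pt (weight V (val l)) i else 0)
    (fun q => sv (weight V (val l)) (lift j q))
    (fun q => st (weight V (val l)) (lift j q))).
have WS1 : weight_system W1 by apply: point_line_weight_system; rewrite ?v1 ?c0.
have summable : point_summable W1 W2 ord0 ord0.
  split=> [l|l||].
  - by rewrite -/(pt _ _) pt_mkw.
  - by rewrite -/(pt _ _) pt_mkw unlift_none.
  - by rewrite /= unlift_none mulrN opprK.
  - by rewrite /= unlift_none sqrrN.
have neq0 (q : 'I_n) : lift ord0 q != ord0 by rewrite eq_sym neq_lift.
(* The first summand is empty, [ord0] being the only point of [W1]; the inverse comes from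
   counting. *)
pose f' (i : 'I_n) : {q : 'I_1 | q != ord0} + {q : 'I_n.+1 | q != ord0} :=
  inr (exist _ (lift ord0 i) (neq0 i)).
pose g (q : 'I_1 + 'I_m.-1) : 'I_m :=
  match q with inl _ => j | inr q => lift j q end.
have [f fK f'K] : bijective f'.
  apply: inj_card_bij => [q q'|].
    move/(congr1 (fun y => if y is inr z then val z else ord0)) => /=.
    exact: lift_inj.
  by rewrite card_sum !card_sig_neq !card_ord.
have gb : bijective g.
  apply: inj_card_bij => [[q|q] [q'|q'] //= E|].
  - by rewrite !ord1.
  - by have := neq_lift j q'; rewrite -E eqxx.
  - by have := neq_lift j q; rewrite E eqxx.
  - by congr inr; apply: lift_inj E.
  by rewrite card_sum !card_ord; lia.
have same : same_up_to_reindexing V (point_sum W1 W2 ord0 ord0).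
  apply: (same_up_to_reindexing_inv (Bijective f'K fK) gb add_k_bij).
  - by move=> i; rewrite -[in X in pair_equiv _ X](f'K i) /= liftK; constructor.
  - by move=> [].
  - by move=> [] // q; rewrite /= dE.
  - move=> l i; rewrite -[in RHS](f'K i) pt_point_sum.
    by case: l => [[]|l] /=; rewrite ?p0 // pt_mkw liftK.
  - move=> [[]|l] [q|q]; rewrite sv_point_sum st_point_sum ?sv_mkw ?st_mkw //=.
    + by apply: off; rewrite eq_sym neq_lift.
    + by apply: surface_kill; rewrite ?(valP l).
exists unit, K2, W1, W2; split=> //; last by left; exists ord0, ord0.
apply: (point_sum_right summable) => //; first by rewrite !card_ord; lia.
exact: weight_system_reindex same HV.
Qed.

Let multiple_of_tau (y : dual p) : y`_0 = 0 -> exists z, y = z * tau p.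
Proof.
move=> y0; exists (y`_1 *: 1); apply: dualP; rewrite !dualE ?y0 ?mulr0 //.
by rewrite !mulr1 addr0.
Qed.

(** Here the sum is along the line, so the weight of [point_line] is shifted by - v c: it becomes v
    tau on the line and - v c at the point, as [point_tau_values] demands. The surface [j] is
    shared, its delta splitting as 1 + (delta - 1). *)
Lemma split_point_tau i j : pt x i != 0 -> st x j != 0 ->
  (forall q, q != i -> pt x q = 0) -> (forall q, sv x q = 0) ->
  (forall q, q != j -> st x q = 0) ->
  is_connected_sum 1 1 n.-1 m V.
Proof.
move=> z0 v0 offp s0 offs.
have [eE rE zE v1] := point_tau_values (F := 'F_p) (H := wring p 'I_n 'I_m)
  (pt := @pt _ _ _) (sv := @sv _ _ _) (st := @st _ _ _)
  (@ptM _ _ _) (@svM _ _ _)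
  (@stM _ _ _) (@pt_sc _ _ _) (@sv_sc _ _ _) (@sc1 _ _ _) brE e0 c0 brx brxx
  erefl rho1 rho2 z0 v0 offp s0 offs (sv_rho V j).
have n_gt0 : (0 < n)%N by case: (i) => a; lia.
set c := wc V j in zE; set v := st x j in zE v1.
have zz : pt x i ^+ 2 = c ^+ 2 by rewrite zE sqrrN exprMn v1 mul1r.
pose W1 := shift (point_line c v) (fun=> - (v * c)).
pose W2 : weight_data p 'I_n.-1 'I_m K2 := WeightData
  (fun q => wa V (lift i q)) (fun q => wb V (lift i q)) (wc V)
  (fun q => if q == j then wdelta V q - 1 else wdelta V q)
  (fun l => mkw (fun q => pt (weight V (val l)) (lift i q))
    (sv (weight V (val l))) (st (weight V (val l)))).
have WS1 : weight_system W1.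
  by apply/shift_weight_system/point_line_weight_system; rewrite ?v1 ?c0.
have w1E l : weight W1 l
    = mkw (fun=> 0) (fun=> v * c) (fun=> v) + sc (- (v * c)).
  by rewrite scE.
have pt_w1 l q : pt (weight W1 l) q = - (v * c).
  by rewrite w1E ptD pt_mkw pt_sc add0r.
have sv_w1 l q : sv (weight W1 l) q = 0.
  by rewrite w1E svD sv_mkw sv_sc subrr.
have st_w1 l q : st (weight W1 l) q = v.
  by rewrite w1E stD st_mkw st_sc addr0.
have summable : surface_summable W1 W2 ord0 j.
  split=> // l; apply: multiple_of_tau; rewrite -/(sv _ _) ?sv_w1 //.
  by rewrite sv_mkw tau_kill // (valP l).
pose f (q : 'I_1 + 'I_n.-1) : 'I_n :=
  match q with inl _ => i | inr q => lift i q end.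
pose g (q : 'I_1 + {q : 'I_m | q != j}) : 'I_m :=
  match q with inl _ => j | inr q => val q end.
have fb : bijective f.
  apply: inj_card_bij => [[q|q] [q'|q'] //= E|].
  - by rewrite !ord1.
  - by have := neq_lift i q'; rewrite -E eqxx.
  - by have := neq_lift i q; rewrite E eqxx.
  - by congr inr; apply: lift_inj E.
  by rewrite card_sum !card_ord; lia.
have gb : bijective g.
  apply: inj_card_bij => [[q|q] [q'|q'] //= E|].
  - by rewrite !ord1.
  - by have := valP q'; rewrite /= -E eqxx.
  - by have := valP q; rewrite /= E eqxx.
  - by congr inr; apply: val_inj.
  by rewrite card_sum card_sig_neq !card_ord; case: (j) => a; lia.
have same : same_up_to_reindexing V (surface_sum W1 W2 ord0 j).
  apply: (same_up_to_reindexing_inv fb gb add_k_bij).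
  - move=> [q|q] /=; last by constructor.
    apply: pair_equiv_of_invariants; rewrite ?a0 //.
      by rewrite eE zz expr2.
    by rewrite -pt_rho rE zz mulr_natl mulr2n.
  - by move=> [].
  - move=> [q|q] /=; first by rewrite ord1 !eqxx addrC subrK.
    by rewrite (negbTE (valP q)).
  - move=> [[]|l] [q|q]; rewrite pt_surface_sum ?pt_w1 ?pt_mkw //=.
    + by rewrite offp // eq_sym neq_lift.
    + by rewrite pt_kill // (valP l).
  - move=> [[]|l] [q|q]; rewrite sv_surface_sum st_surface_sum.
    + by rewrite sv_w1 st_w1 /= s0.
    + by rewrite /= s0 offs // (valP q).
    + by rewrite ord1 eqxx sv_mkw st_mkw.
    + by rewrite sv_mkw st_mkw.
exists unit, K2, W1, W2; split=> //; last by right; exists ord0, j.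
apply: (surface_sum_right summable) => //; first by rewrite !card_ord; lia.
exact: weight_system_reindex same HV.
Qed.

End Splitting.

Theorem theorem5p14 (p n m t : nat) (K : finType)
    (W : weight_data p 'I_n 'I_m K) :
  prime p -> (7 <= p)%N -> (n + 2 * m = t + 3)%N -> (0 < t)%N ->
  weight_system W ->
  exists s : K -> 'F_p,
    [\/ (0 < n)%N /\ is_connected_sum 3 0 n.-1 m (shift W s),
        (0 < m)%N /\ is_connected_sum 1 1 n.+1 m.-1 (shift W s) |
        (0 < n)%N /\ is_connected_sum 1 1 n.-1 m (shift W s)].
Proof.
move=> pp p7 nm t0 HW.
have K1 : (1 < #|K|)%N by have := card_weights HW; rewrite !card_ord; lia.
have [k [s kill]] := exists_isolated pp p7 HW K1.
have HV := shift_weight_system s HW.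
have nm4 : (4 <= n + 2 * m)%N by lia.
(* An index in the support shows that the predecessor in the type of [W2] is a true difference. *)
have pos (q : nat) (i : 'I_q) : (0 < q)%N by exact: leq_ltn_trans (ltn_ord i).
exists s; case: (weight_support pp p7 HV nm4 kill).
- move=> [i [i' [ii' xi xi' off s0]]]; constructor 1.
  by split; [exact: pos i | exact: split_two_points ii' xi xi' off s0].
- move=> [j [xj p0 off]]; constructor 2.
  by split; [exact: pos j | exact: split_surface xj p0 off].
move=> [i [j [xi xj offp s0 offs]]]; constructor 3.
by split; [exact: pos i | exact: split_point_tau xi xj offp s0 offs].
Qed.
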